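(* Let $(\Omega,d)$ be a Polish metric space and $p\ge 1$. Suppose $\{\mathcal{P}_n\}_{n=1}^\infty$ and $\mathcal{P}$ are elements of the Wasserstein space $\mathcal{P}_p(\Omega)$. Then the following statements are equivalent: (i) $\mathcal{W}_p(\mathcal{P}_n,\mathcal{P})\to 0$ as $n\to\infty$. (ii) For each continuous function $\varphi:\Omega\to\mathbb{R}$ satisfying the growth condition that, for some $\omega_0\in\Omega$ and some constant $C$, $|\varphi(\omega)|\le C(1+d(\omega_0,\omega)^p)$ for all $\omega\in\Omega$, we have $\lim_{n\to\infty}\mathbb{E}^{\mathcal{P}_n}[\varphi]=\mathbb{E}^{\mathcal{P}}[\varphi]$. (iii) $\{\mathbb{E}^{\mathcal{P}_n}[\cdot]\}_{n=1}^\infty$ converges weakly to $\mathbb{E}^{\mathcal{P}}[\cdot]$, and $$\lim_{K\to\infty}\limsup_{n\to\infty}\mathbb{E}^{\mathcal{P}_n}\big[d(\omega_0,\cdot)^p\,\mathbf{1}_{\{\omega\in\Omega:\ d(\omega_0,\omega)\ge K\}}\big]=0,$$ where $\omega_0\in\Omega$ is an arbitrary fixed point.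
   Context: $(\Omega,d)$ is a Polish metric space with its Borel $\sigma$-algebra; all probability measures are Borel probability measures on $\Omega$, and $E_\mu[\varphi]$ denotes the integral of $\varphi$ with respect to $\mu$. All sets of probability measures considered are nonempty. For a set $\mathcal{P}$ of probability measures, the sublinear expectation is $\mathbb{E}^{\mathcal{P}}[\varphi]:=\sup_{\mu\in\mathcal{P}}E_\mu[\varphi]$ for real Borel functions $\varphi$. The sequence $\{\mathbb{E}^{\mathcal{P}_n}[\cdot]\}$ converges weakly to $\mathbb{E}^{\mathcal{P}}[\cdot]$ if $\lim_{n\to\infty}\mathbb{E}^{\mathcal{P}_n}[\varphi]=\mathbb{E}^{\mathcal{P}}[\varphi]$ for every bounded continuous $\varphi:\Omega\to\mathbb{R}$. For $p\ge 1$, $W_p(\mu,\nu)=\inf\{E[d(X,Y)^p]^{1/p}:\ \mathrm{law}(X)=\mu,\ \mathrm{law}(Y)=\nu\}$ is the classical Wasserstein distance of order $p$. For sets $\mathcal{P}_1,\mathcal{P}_2$ of probability measures, the generalized Wasserstein distance is $$\mathcal{W}_p(\mathcal{P}_1,\mathcal{P}_2)=\max\Big(\sup_{\mu\in\mathcal{P}_1}\inf_{\nu\in\mathcal{P}_2}W_p(\mu,\nu),\ \sup_{\nu\in\mathcal{P}_2}\inf_{\mu\in\mathcal{P}_1}W_p(\mu,\nu)\Big).$$ For $p\ge1$, $\mathcal{P}_p(\Omega)$ is the collection of all sets $\mathcal{P}$ of probability measures such that (a) $\mathcal{P}$ is convex and weakly compact (compact for the topology of weak convergence of probability measures); (b)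 for an arbitrary point $\omega_0\in\Omega$, $\lim_{K\to\infty}\mathbb{E}^{\mathcal{P}}[d(\omega_0,\cdot)^p\mathbf{1}_{\{\omega:\ d(\omega_0,\omega)\ge K\}}]=0$ (this does not depend on the choice of $\omega_0$). *)

(* Defs.v *)
From HB Require Import structures.
From mathcomp Require Import all_boot all_order all_algebra.
From mathcomp Require Import all_classical all_reals all_analysis.

Set Implicit Arguments.
Unset Strict Implicit.
Unset Printing Implicit Defensive.

Import Order.TTheory GRing.Theory Num.Theory.
Import numFieldNormedType.Exports.

Local Open Scope classical_set_scope.
Local Open Scope ring_scope.

HB.mixin Record isSeparable (T : Type) & Topological T := {
  separable_ex : exists2 D : set T, countable D & dense D
}.

(* Complete separable metric spaces. The library makes [completeType] and
   [measurableType] pointed, so the space is nonempty; this loses nothing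
   here, as there is no probability measure on the empty space. *)
#[short(type="polishMetricType")]
HB.structure Definition PolishMetric (R : numDomainType) :=
  {T of Complete T & Metric R T & isSeparable T}.

Notation borel T := (g_sigma_algebraType (@open T)).

Section sublinear_expectation.
Context {R : realType} {T : polishMetricType R}.
Local Notation prob := (probability (borel T) R).

Definition bounded_continuous : set (T -> R) :=
  [set phi | continuous phi /\ [bounded phi x | x in setT]].

(* Probability measures with the topology of weak convergence: the coarsest
   topology making mu |-> \int phi dmu continuous for every bounded continuous
   phi, i.e. the one induced by the product topology on R^(Cb(T)). *)
Definition integrate_Cb (mu : prob) :
    {ptws set_type bounded_continuous -> R} :=
  fun phi => (\int[mu]_x \val phi x)%R.

Definition weak_prob := initial_topology integrate_Cb.

Definition weakly_compact (P : set prob) : Prop :=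
  compact (P : set weak_prob).

(* Elements of [prob] are functions on all subsets, of which only the
   restriction to Borel sets is meaningful: equalities between measures are
   therefore stated on Borel sets, and sets of measures are considered up to
   that equality. *)
Definition convex_probs (P : set prob) : Prop :=
  forall (mu nu : prob) (t : R), P mu -> P nu -> 0 <= t <= 1 ->
  exists2 rho : prob, P rho &
    forall A, measurable A -> rho A = (t%:E * mu A + (1 - t)%:E * nu A)%E.

Definition sublinE (P : set prob) (phi : T -> R) : \bar R :=
  ereal_sup [set (\int[mu]_x (phi x)%:E)%E | mu in P].

Definition dist_tail (p : R) (w0 : T) (K : R) (w : T) : R :=
  mdist w0 w `^ p * \1_[set x | K <= mdist w0 x] w.

Definition sublinE_cvg_weakly (Pn : nat -> set prob) (P : set prob) : Prop :=
  forall phi : T -> R, bounded_continuous phi ->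
  sublinE (Pn n) phi @[n --> \oo] --> sublinE P phi.

Definition has_law d (S : measurableType d) (Q : probability S R)
    (X : {mfun S >-> borel T}) (mu : prob) : Prop :=
  forall A, measurable A -> distribution Q X A = mu A.

Definition wasserstein_dist (p : R) (mu nu : prob) : \bar R :=
  ereal_inf [set r | exists (d : measure_display) (S : measurableType d)
      (Q : probability S R) (X Y : {mfun S >-> borel T}),
    [/\ has_law Q X mu, has_law Q Y nu &
        r = ((\int[Q]_s ((mdist (X s : T) (Y s : T)) `^ p)%:E) `^ p^-1)%E]].

Definition gen_wasserstein_dist (p : R) (P1 P2 : set prob) : \bar R :=
  Order.max
    (ereal_sup [set ereal_inf [set wasserstein_dist p mu nu | nu in P2]
               | mu in P1])
    (ereal_sup [set ereal_inf [set wasserstein_dist p mu nu | mu in P1]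
               | nu in P2]).

Definition wasserstein_space (p : R) : set (set prob) :=
  [set P | [/\ P !=set0, convex_probs P, weakly_compact P &
    forall w0 : T, sublinE P (dist_tail p w0 K) @[K --> +oo] --> 0%E]].

End sublinear_expectation.

(* Main.v *)
Require Import Defs.
From HB Require Import structures.
From mathcomp Require Import all_boot all_order all_algebra.
From mathcomp Require Import all_classical all_reals all_analysis.
From mathcomp Require Import measurable_realfun.
From mathcomp Require Import ring lra.

Set Implicit Arguments.
Unset Strict Implicit.
Unset Printing Implicit Defensive.

Import Order.TTheory GRing.Theory Num.Theory.
Import numFieldNormedType.Exports.

Local Open Scope classical_set_scope.
Local Open Scope ring_scope.

(** Convergence of suprema of expectations is handled through the relation
    [dominated e phi A B]: every expectation of [phi] over [A] exceeds some
    expectation over [B] by at most [e].  When the suprema are finite,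
    [sublinE (Pn n) phi] converges to [sublinE P phi] exactly when, for each
    [e > 0], domination eventually holds in both directions ([sublinE_cvgP]).

    (ii) <-> (iii).  The tail of order K lies below a continuous function of
    growth p that itself lies below the tail of order K - 1, so convergence on
    functions of growth p carries small tails from [P] to the [Pn]
    ([growth_cvg_tails]).  Conversely, a function of growth p differs from a
    bounded continuous truncation by at most a multiple of a tail
    ([weak_tails_growth_cvg]).

    (i) -> (iii).  If (X, Y) couples mu and nu, the tail of mu of order 2 K is
    at most 2^p times the sum of the tail of nu of order K and of E d(X, Y)^p
    ([dist_tail_coupling]).  For a bounded continuous phi the sup-convolutions
    phi^k(y) = sup_x (phi(x) - k d(x, y)) satisfy phi(X) <= phi^k(Y) + k d(X, Y)
    and decrease to phi; Dini's theorem on the weakly compact set [P]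
    ([dini_compact]) makes the suprema of E phi^k over [P] decrease to the
    supremum of E phi ([coupled_sup_conv], [wasserstein_cvg_weakly]).

    (iii) -> (i).  An explicit coupling is built.  Take a partition of unity
    into finitely many bumps f_i supported in small balls, up to a remainder;
    Dini's theorem makes the mass of the remainder uniformly small on [P], and
    weak convergence transfers this to the [Pn].  Suppose mu and nu give almost
    the same mass to each f_i.  The common mass of f_i can be moved inside its
    small ball, and the little mass left over is moved arbitrarily: its cost is
    at most a constant times the sum of K^p times its total mass and of the
    tails of order K ([partition_coupled], [close_parts_coupled]).  To find such
    a nu for a given mu, observe that the vectors (E f_i) form convex sets in R^m
    whose support functions are sublinear expectations of linear combinations of
    the f_i.
    These converge by (iii), and a finite set of directions is enough to
    separate a point from a convex set at a given distance
    ([finitely_many_directions]), so the matching holds for all mu of [Pn n] and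
    for all mu of [P] as soon as n is large ([weak_cvg_matches_parts]). *)

(** * Continuity and measurability on a Polish metric space *)

Section metric.
Context {R : realType} {T : polishMetricType R}.
Implicit Types x y z : T.

Lemma mdist_sub_le x y z : `|mdist x y - mdist x z| <= mdist y z.
Proof.
rewrite ler_distl; have := metric_triangle x y z; have := metric_triangle x z y.
by rewrite (metric_sym z y); lra.
Qed.

Lemma lipschitz_continuous (k : R) (f : T -> R) : 0 <= k ->
  (forall y z, `|f y - f z| <= k * mdist y z) -> continuous f.
Proof.
move=> k0 fk y; apply/cvgrPdist_lt => e e0.
have k1 : 0 < k + 1 by lra.
apply/metricType_numDomainType.nbhs_mdistP; exists (e / (k + 1)) => /=.
  by rewrite divr_gt0.
move=> z /=; rewrite ltr_pdivlMr// => yz; apply: le_lt_trans (fk _ _) _.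
by have := mdist_ge0 y z; nra.
Qed.

Lemma continuous_mdist x : continuous (mdist x).
Proof.
apply: (@lipschitz_continuous 1) => // y z; rewrite mul1r; exact: mdist_sub_le.
Qed.

Lemma borel_measurable_continuous (f : T -> R) :
  continuous f -> measurable_fun setT (f : borel T -> R).
Proof.
move=> /continuousP cf; apply: (measurability _ (RGenOpens.measurableE R)).
move=> _ [_ [a [b ->] <-]]; rewrite setTI; apply: sub_sigma_algebra.
by apply: cf; exact: interval_open.
Qed.

Lemma dense_sequence :
  exists q : nat -> T, forall y (r : R), 0 < r -> exists i, mdist (q i) y < r.
Proof.
have [D /countable_injP[f finj] dD] := @separable_ex R T.
exists (fun i => get [set x | D x /\ f x = i]) => y r r0.
have [oy ny] := open_nbhs_ball y (PosNum r0).
have [|x [/interior_subset yx Dx]] := dD _ _ oy.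
  by exists y.
exists (f x); have [Dz fz] : [set z | D z /\ f z = f x] (get [set z | D z /\ f z = f x]).
  by apply: getPex; exists x.
rewrite (finj _ _ _ _ fz) ?inE// metric_sym.
by move: yx; rewrite ballEmdist.
Qed.

(** The distance is jointly measurable for the product sigma-algebra because the
    space is separable: d(x, y) < a exactly when some point z of a countable
    dense set has d(z, x) + d(z, y) < a. *)
Lemma measurable_mdist d (S : measurableType d) (X Y : S -> borel T) :
  measurable_fun setT X -> measurable_fun setT Y ->
  measurable_fun setT (fun s => mdist (X s : T) (Y s : T)).
Proof.
move=> mX mY; have [q qd] := dense_sequence.
have mq i (Z : S -> borel T) : measurable_fun setT Z ->
    measurable_fun setT (fun s => mdist (q i) (Z s : T)).
  move=> mZ; apply: (@measurableT_comp _ _ _ _ _ _ (mdist (q i) : borel T -> R)) mZ => //.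
  by apply: borel_measurable_continuous; exact: continuous_mdist.
apply: (measurability _ (RGenInftyO.measurableE R)).
move=> _ [_ [a ->] <-]; rewrite setTI.
rewrite (_ : _ @^-1` _ = \bigcup_i
    ((fun s => mdist (q i) (X s : T) + mdist (q i) (Y s : T)) @^-1` `]-oo, a[)).
  apply: bigcup_measurable => i _; rewrite -[_ @^-1` _]setTI.
  apply: measurable_funD => //; exact: mq.
apply/seteqP; split => s /=; rewrite in_itv /=.
  move=> sa; have [|i qi] := qd (X s) ((a - mdist (X s : T) (Y s : T)) / 2); first by lra.
  exists i => //=; rewrite in_itv /=.
  by have := metric_triangle (q i) (X s) (Y s); lra.
move=> [i _] /=; rewrite in_itv/= => /le_lt_trans; apply.
by rewrite (metric_sym (q i) (X s)) metric_triangle.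
Qed.

Lemma powRD_le (p a b : R) : 0 <= p -> 0 <= a -> 0 <= b ->
  (a + b) `^ p <= 2 `^ p * (a `^ p + b `^ p).
Proof.
move=> p0 a0 b0.
wlog ab : a b a0 b0 / a <= b.
  move=> H; have [ab|/ltW ba] := leP a b; first exact: H.
  by rewrite addrC [X in _ <= _ * X]addrC; exact: H.
apply: (@le_trans _ _ ((2 * b) `^ p)).
  by apply: ge0_ler_powR => //; rewrite ?nnegrE; lra.
by rewrite powRM// ler_wpM2l ?powR_ge0// lerDr powR_ge0.
Qed.

(** The real power is not continuous from the left at 0, so points at distance
    zero are treated apart, with d^p <= d for d <= 1. *)
Lemma continuous_mdist_powR (p : R) x : 1 <= p -> continuous (fun y => mdist x y `^ p).
Proof.
move=> p1 y; have [xy|xy] := eqVneq (mdist x y) 0.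
  apply/cvgrPdist_lt => e e0; near=> z.
  rewrite xy powR0 ?gt_eqF//; last by lra.
  rewrite sub0r normrN ger0_norm ?powR_ge0//.
  have zlt : mdist x z < Num.min 1 e.
    near: z; have := @continuous_mdist x y; rewrite /continuous_at xy.
    move=> /cvgrPdist_lt/(_ (Num.min 1 e)) H.
    have : 0 < Num.min 1 e by rewrite lt_min ltr01.
    by move=> /H; apply: filterS => z; rewrite sub0r normrN ger0_norm// mdist_ge0.
  move: zlt; rewrite lt_min => /andP[z1 ze].
  have [->|z0] := eqVneq (mdist x z) 0; first by rewrite powR0//; lra.
  apply: le_lt_trans ze; apply: ge1r_powR => //.
  by rewrite lt_neqAle eq_sym z0 mdist_ge0 ltW.
apply: (@continuous_comp _ _ _ (mdist x) (fun t => t `^ p)).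
  exact: continuous_mdist.
apply: differentiable_continuous; apply/derivable1_diffP.
by apply: derivable_powR; rewrite in_itv/= andbT lt_neqAle eq_sym xy mdist_ge0.
Unshelve. all: by end_near. Qed.

End metric.

(** * Convergence of suprema of expectations *)

Lemma ereal_cvg_finP (R : realType) {I : Type} {F : set_system I}
    {FF : ProperFilter F} (u : I -> \bar R) (s : R) :
  u @ F --> s%:E <->
  forall e : R, 0 < e -> \forall n \near F, ((s - e)%:E <= u n <= (s + e)%:E)%E.
Proof.
split=> [/fine_cvgP[uf /cvgrPdist_le us] e e0|H].
  near=> n; have un : u n \is a fin_num by near: n.
  have : `|s - fine (u n)| <= e by near: n; exact: us.
  by rewrite -[u n]fineK// !lee_fin ler_distl; lra.
apply/fine_cvgP; split.
  near=> n; have /andP[h1 h2] : ((s - 1)%:E <= u n <= (s + 1)%:E)%E.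
    by near: n; exact: H.
  by rewrite fin_numE; apply/andP; split; apply/eqP => un; rewrite un in h1 h2.
apply/cvgrPdist_le => e e0; near=> n.
have /andP[h1 h2] : ((s - e)%:E <= u n <= (s + e)%:E)%E by near: n; exact: H.
rewrite /=; case: (u n) h1 h2 => //= r; rewrite !lee_fin ler_distl => *; lra.
Unshelve. all: by end_near. Qed.

Section expectation.
Context {R : realType} {T : polishMetricType R}.
Local Notation prob := (probability (borel T) R).
Implicit Types (mu nu : prob) (P A B : set prob) (phi psi : T -> R).

Definition expect (mu : prob) (phi : T -> R) : R := (\int[mu]_x phi x)%R.

Definition integrable_under (mu : prob) (phi : T -> R) :=
  mu.-integrable setT (EFin \o (phi : borel T -> R)).

(** The inequality sublinE A phi <= sublinE B phi + e, up to an arbitrarily small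
    loss, without mentioning suprema. *)
Definition dominated (e : R) (phi : T -> R) (A B : set prob) :=
  forall mu, A mu -> exists2 nu, B nu & expect mu phi <= expect nu phi + e.

Lemma integral_expect mu phi : integrable_under mu phi ->
  (\int[mu]_x (phi x)%:E)%E = (expect mu phi)%:E.
Proof. by move=> i; rewrite /expect /Rintegral fineK//; exact: integrable_fin_num. Qed.

Lemma near_sup P phi M : P !=set0 -> (forall mu, P mu -> expect mu phi <= M) ->
  forall e : R, 0 < e ->
  exists2 nu, P nu & forall mu, P mu -> expect mu phi <= expect nu phi + e.
Proof.
move=> [mu0 P0] PM e e0.
have hs : has_sup [set expect mu phi | mu in P].
  by split; [exists (expect mu0 phi), mu0|exists M => _ [mu Pmu <-]; exact: PM].
have [_ [nu Pnu <-] nue] := sup_adherent e0 hs.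
exists nu => // mu Pmu; apply: (@le_trans _ _ (sup [set expect mu phi | mu in P])).
  by apply: ub_le_sup; [case: hs|exists mu].
by rewrite -lerBlDr ltW.
Qed.

Lemma sublinE_sup P phi M : P !=set0 -> (forall mu, P mu -> integrable_under mu phi) ->
  (forall mu, P mu -> expect mu phi <= M) ->
  exists s : R, [/\ sublinE P phi = s%:E,
    forall mu, P mu -> expect mu phi <= s &
    forall e : R, 0 < e -> exists2 nu, P nu & s - e <= expect nu phi].
Proof.
move=> P0 iP PM.
have sE : sublinE P phi = ereal_sup [set (expect mu phi)%:E | mu in P].
  rewrite /sublinE; congr ereal_sup; apply/seteqP; split => _ [mu Pmu <-];
    by exists mu => //; rewrite integral_expect//; exact: iP.
have sfin : sublinE P phi \is a fin_num.
  rewrite sE; case: P0 => mu0 Pmu0; rewrite fin_numElt; apply/andP; split.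
    apply: (@lt_le_trans _ _ (expect mu0 phi)%:E); first exact: ltNyr.
    by apply: ereal_sup_ubound; exists mu0.
  apply: (@le_lt_trans _ _ M%:E); last exact: ltry.
  by apply: ge_ereal_sup => _ [mu Pmu <-]; rewrite lee_fin PM.
have sK := fineK sfin.
exists (fine (sublinE P phi)); split => //.
  move=> mu Pmu; rewrite -lee_fin sK sE; apply: ereal_sup_ubound.
  by exists mu.
move=> e e0; have [nu Pnu nuE] := near_sup P0 PM e0.
exists nu => //; rewrite lerBlDr -lee_fin fineK// sE.
by apply: ge_ereal_sup => _ [mu Pmu <-]; rewrite lee_fin nuE.
Qed.

(** Reduces convergence of sublinear expectations to statements on single
    measures: nearly optimal elements replace the suprema. *)
Lemma sublinE_cvgP (Pn : nat -> set prob) P phi M :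
  (forall n, Pn n !=set0) -> P !=set0 ->
  (forall n mu, Pn n mu -> integrable_under mu phi) ->
  (forall mu, P mu -> integrable_under mu phi) ->
  (forall mu, P mu -> expect mu phi <= M) ->
  sublinE (Pn n) phi @[n --> \oo] --> sublinE P phi <->
  forall e : R, 0 < e ->
    \forall n \near \oo, dominated e phi (Pn n) P /\ dominated e phi P (Pn n).
Proof.
move=> Pn0 P0 iPn iP PM.
have [s [-> sub sup]] := sublinE_sup P0 iP PM.
split => [/ereal_cvg_finP H e e0|H].
  have e2 : 0 < e / 2 by lra.
  apply: filterS (H _ e2) => n /andP[h1 h2]; split.
    have [nu Pnu nus] := sup _ e2; move=> mu Pmu; exists nu => //.
    rewrite -lee_fin; apply: (@le_trans _ _ (sublinE (Pn n) phi)).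
      by rewrite -integral_expect; [apply: ereal_sup_ubound; exists mu|exact: iPn Pmu].
    by apply: le_trans h2 _; rewrite lee_fin; lra.
  have ub mu : Pn n mu -> expect mu phi <= s + e / 2.
    move=> Pmu; rewrite -lee_fin; apply: le_trans h2.
    by rewrite -integral_expect; [apply: ereal_sup_ubound; exists mu|exact: iPn Pmu].
  have [t [tE _ tsup]] := sublinE_sup (Pn0 n) (iPn n) ub.
  move=> mu Pmu; have [nu Pnu nut] := tsup _ e2; exists nu => //.
  by have := sub _ Pmu; move: h1; rewrite tE lee_fin; lra.
apply/ereal_cvg_finP => e e0; have e2 : 0 < e / 2 by lra.
apply: filterS (H _ e2) => n [d1 d2]; apply/andP; split.
  have [nu Pnu nus] := sup _ e2; have [mu Pmu mun] := d2 _ Pnu.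
  apply: (@le_trans _ _ (expect mu phi)%:E); first by rewrite lee_fin; lra.
  by rewrite -integral_expect; [apply: ereal_sup_ubound; exists mu|exact: iPn Pmu].
apply: ge_ereal_sup => _ [mu Pmu <-]; rewrite integral_expect; last exact: iPn Pmu.
have [nu Pnu nus] := d1 _ Pmu.
by have := sub _ Pnu; rewrite lee_fin; lra.
Qed.

Lemma integrable_underD mu phi psi : integrable_under mu phi ->
  integrable_under mu psi -> integrable_under mu (phi \+ psi).
Proof. by move=> i1 i2; have := integrableD measurableT i1 i2. Qed.

Lemma integrable_underZ mu phi (k : R) : integrable_under mu phi ->
  integrable_under mu (fun x => k * phi x).
Proof. by move=> i1; have := integrableZl measurableT k i1. Qed.

Lemma integrable_under_cst mu (k : R) : integrable_under mu (cst k).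
Proof. exact: finite_measure_integrable_cst. Qed.

Lemma integrable_under_le mu phi psi :
  measurable_fun setT (phi : borel T -> R) -> integrable_under mu psi ->
  (forall x, `|phi x| <= psi x) -> integrable_under mu phi.
Proof.
move=> mphi ipsi le; apply: le_integrable ipsi => //.
  exact/measurable_EFinP.
by move=> x _ /=; rewrite lee_fin (le_trans (le x))// ler_norm.
Qed.

Lemma expectD mu phi psi : integrable_under mu phi -> integrable_under mu psi ->
  expect mu (phi \+ psi) = expect mu phi + expect mu psi.
Proof. by move=> i1 i2; rewrite /expect RintegralD. Qed.

Lemma expectB mu phi psi : integrable_under mu phi -> integrable_under mu psi ->
  expect mu (phi \- psi) = expect mu phi - expect mu psi.
Proof. by move=> i1 i2; rewrite /expect RintegralB. Qed.

Lemma expectZ mu phi (k : R) : integrable_under mu phi ->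
  expect mu (fun x => k * phi x) = k * expect mu phi.
Proof. by move=> i1; rewrite /expect RintegralZl. Qed.

Lemma expect_cst mu (k : R) : expect mu (cst k) = k.
Proof.
rewrite /expect Rintegral_cst//.
rewrite [X in k * fine X](_ : _ = 1%E) ?mulr1//; exact: probability_setT.
Qed.

Lemma expect_le mu phi psi : integrable_under mu phi -> integrable_under mu psi ->
  (forall x, phi x <= psi x) -> expect mu phi <= expect mu psi.
Proof. by move=> i1 i2 le; apply: le_Rintegral => // x _; exact: le. Qed.

Lemma expect_dist_le mu phi psi g : integrable_under mu phi -> integrable_under mu psi ->
  integrable_under mu g -> (forall x, `|phi x - psi x| <= g x) ->
  `|expect mu phi - expect mu psi| <= expect mu g.
Proof.
move=> i1 i2 ig le; rewrite ler_distl lerBlDr -!expectD//.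
by apply/andP; split; apply: expect_le => //; try exact: integrable_underD;
  move=> x /=; move: (le x); rewrite ler_distl; lra.
Qed.

Lemma integrable_under_bounded_continuous mu phi : bounded_continuous phi ->
  integrable_under mu phi.
Proof.
move=> [cphi bphi]; apply: measurable_bounded_integrable => //.
  by rewrite -ge0_fin_numE// fin_num_measure.
exact: borel_measurable_continuous.
Qed.

End expectation.

(** * Dini's theorem on weakly compact sets of measures *)

Section dini.
Context {R : realType} {T : polishMetricType R}.
Local Notation prob := (probability (borel T) R).
Implicit Types (mu nu : prob) (P : set prob) (phi psi : T -> R).

Lemma bounded_continuousP phi : bounded_continuous phi <->
  continuous phi /\ exists M : R, forall x, `|phi x| <= M.
Proof.
split => [[cphi [M [_ MP]]]|[cphi [M MP]]]; split => //.
  by exists (M + 1) => x; apply: MP => //; rewrite ltrDl.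
exists M; split; first exact: num_real.
by move=> N MN x _; apply: le_trans (MP x) (ltW MN).
Qed.

(** Holds by construction: the topology is the initial one for these maps. *)
Lemma expect_weak_continuous phi : bounded_continuous phi ->
  continuous (expect ^~ phi : weak_prob -> R).
Proof.
move=> bphi; pose phi' : set_type bounded_continuous := SigSub (mem_set bphi).
move=> mu; apply: (@continuous_comp (@weak_prob R T)
  {ptws set_type (@bounded_continuous R T) -> R} R integrate_Cb (fun f => f phi')).
  exact: initial_continuous.
exact: (@proj_continuous _ (fun=> R)).
Qed.

Lemma expect_cvg mu (psi_ : nat -> T -> R) psi (M : R) :
  (forall k, continuous (psi_ k)) -> continuous psi ->
  (forall k x, `|psi_ k x| <= M) ->
  (forall x, psi_ k x @[k --> \oo] --> psi x) ->
  expect mu (psi_ k) @[k --> \oo] --> expect mu psi.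
Proof.
move=> ck c kM kpsi; apply: fine_cvg.
have mE (f : T -> R) : continuous f -> measurable_fun setT (EFin \o (f : borel T -> R)).
  by move=> cf; apply/measurable_EFinP; exact: borel_measurable_continuous.
have [|||||ipsi _ lim] := @dominated_convergence _ (borel T) R mu setT measurableT
  (fun k => EFin \o psi_ k) (EFin \o psi) (cst M%:E).
- by move=> k; exact: mE.
- exact: mE.
- by apply: aeW => x _; apply: cvg_EFin; [exact: nearW|exact: kpsi].
- exact: integrable_under_cst.
- by apply: aeW => x k _ /=; rewrite lee_fin.
- by rewrite fineK//; exact: integrable_fin_num.
Qed.

(** Dini's theorem for the maps mu |-> E_mu psi_k on the compact set P.  They
    decrease to mu |-> E_mu psi by dominated convergence, so near each mu some
    index k already brings E psi_k below the supremum of E psi plus e, and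
    compactness makes a single index work.  A nearly optimal nu stands for that
    supremum. *)
Lemma dini_compact P (psi_ : nat -> T -> R) psi : P !=set0 -> weakly_compact P ->
  (forall k, bounded_continuous (psi_ k)) -> bounded_continuous psi ->
  (forall k x, psi_ k.+1 x <= psi_ k x) ->
  (forall x, psi_ k x @[k --> \oo] --> psi x) ->
  forall e : R, 0 < e ->
  exists k, exists2 nu, P nu & forall mu, P mu -> expect mu (psi_ k) <= expect nu psi + e.
Proof.
move=> P0 cP bk b dk kpsi e e0; have e2 : 0 < e / 2 by lra.
have dkn : forall k l x, (k <= l)%N -> psi_ l x <= psi_ k x.
  move=> k l x /subnKC <-; elim: (l - k)%N => [|i IH]; first by rewrite addn0.
  by rewrite addnS (le_trans (dk _ _)).
have psile k x : psi x <= psi_ k x.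
  apply: (closed_cvg _ (@closed_le _ (psi_ k x)) _ _ (kpsi x)).
  by exists k => // l /= kl; exact: dkn.
have [M MP] : exists M, forall k x, `|psi_ k x| <= M.
  have /bounded_continuousP[_ [M0 M0P]] := bk 0%N.
  have /bounded_continuousP[_ [M1 M1P]] := b.
  exists (M0 + M1) => k x; have := M0P x; have := M1P x.
  have := psile k x; have := dkn 0%N k x isT.
  by rewrite !ler_norml => *; apply/andP; split; lra.
have [nu Pnu nusup] : exists2 nu, P nu &
    forall mu, P mu -> expect mu psi <= expect nu psi + e / 2.
  apply: (@near_sup R T P psi M) => // mu Pmu.
  rewrite -(expect_cst mu M); apply: expect_le.
  - exact: integrable_under_bounded_continuous.
  - exact: integrable_under_cst.
  - by move=> x; apply: le_trans (psile 0%N x) _; exact: le_trans (ler_norm _) (MP _ _).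
have [k _ kP] : \forall k \near \oo, P `<=`
    (fun mu => expect mu (psi_ k) <= expect nu psi + e).
  move/compact_near_coveringP : cP => /(_ nat \oo
    (fun k mu => expect mu (psi_ k) <= expect nu psi + e)); apply => mu Pmu.
  have ck := fun k => (bk k).1.
  have /cvgrPdist_lt/(_ _ e2)[k _ kn] := expect_cvg ck b.1 MP kpsi (mu := mu).
  have {kn} := kn k (leqnn k); rewrite /= distrC ltr_distl => /andP[_ kn].
  have kn' : expect mu (psi_ k) < expect nu psi + e.
    by have := nusup _ Pmu; lra.
  (* The bound at index k holds on a weak neighbourhood of mu, and then at all
     later indices because the sequence decreases. *)
  exists ([set m | expect m (psi_ k) < expect nu psi + e], [set l | (k <= l)%N]).
    split; last by exists k.
    have ck' := expect_weak_continuous (bk k).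
    apply: (ck' (mu : weak_prob) [set r | r < expect nu psi + e]).
    by apply: open_nbhs_nbhs; split => //; exact: open_lt.
  move=> [m l] /= [mk kl]; apply: le_trans (ltW mk).
  by apply: expect_le; [exact: integrable_under_bounded_continuous..|move=> x; exact: dkn].
by exists k, nu => // mu Pmu; exact: (kP k (leqnn k)).
Qed.

End dini.

(** * Cut-offs and tails of moments *)

Section cutoff.
Context {R : realType} {T : polishMetricType R}.

Definition clamp (t : R) : R := Num.max 0 (Num.min 1 t).

Lemma clamp_itv t : 0 <= clamp t <= 1.
Proof.
rewrite /clamp; apply/andP; split; first by rewrite le_max lexx.
by rewrite ge_max ler01 ge_min lexx.
Qed.

Lemma clamp_ge1 t : 1 <= t -> clamp t = 1.
Proof. by move=> t1; rewrite /clamp (min_idPl t1); apply/max_idPr/ler01. Qed.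

Lemma clamp_le0 t : t <= 0 -> clamp t = 0.
Proof. by move=> t0; apply/max_idPl; rewrite ge_min t0 orbT. Qed.

Lemma clamp_lipschitz s t : `|clamp s - clamp t| <= `|s - t|.
Proof.
wlog st : s t / s <= t.
  by move=> H; have [/H//|/ltW/H] := leP s t; rewrite distrC [leRHS]distrC.
rewrite [leRHS]distrC (ger0_norm (_ : 0 <= t - s)) ?subr_ge0// distrC.
have [s0|s0] := leP s 0.
  rewrite (clamp_le0 s0) subr0; have [t0|t0] := leP t 0.
    by rewrite clamp_le0// normr0 subr_ge0.
  have /andP[c0 _] := clamp_itv t; rewrite ger0_norm//.
  rewrite /clamp ge_max; apply/andP; split; first by lra.
  by rewrite ge_min; apply/orP; right; lra.
have [t1|t1] := leP 1 t.
  rewrite (clamp_ge1 t1); have /andP[_ c1] := clamp_itv s; rewrite ger0_norm ?subr_ge0//.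
  have [s1|s1] := leP 1 s; first by rewrite clamp_ge1//; lra.
  by rewrite /clamp (min_idPr (ltW s1)) (max_idPr (ltW s0)); lra.
have cE r : 0 < r -> r < 1 -> clamp r = r.
  by move=> r0 r1; rewrite /clamp (min_idPr (ltW r1)) (max_idPr (ltW r0)).
by rewrite !cE ?ger0_norm//; lra.
Qed.

Lemma continuous_clamp_mdist (a b : R) (x : T) :
  continuous (fun w => clamp (a + b * mdist x w)).
Proof.
apply: (@lipschitz_continuous _ _ `|b|) => // y z.
apply: le_trans (clamp_lipschitz _ _) _.
rewrite (_ : _ - _ = b * (mdist x y - mdist x z)); last by ring.
by rewrite normrM ler_wpM2l// mdist_sub_le.
Qed.

End cutoff.

Section tails.
Context {R : realType} {T : polishMetricType R}.
Local Notation prob := (probability (borel T) R).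
Implicit Types (mu nu : prob) (P : set prob) (phi psi : T -> R).
Variables (p : R) (p1 : 1 <= p).

Lemma dist_tail_ge (w0 : T) (K : R) w : K <= mdist w0 w ->
  dist_tail p w0 K w = mdist w0 w `^ p.
Proof. by move=> Kw; rewrite /dist_tail indicE mem_set// mulr1. Qed.

Lemma dist_tail_lt (w0 : T) (K : R) w : mdist w0 w < K -> dist_tail p w0 K w = 0.
Proof.
move=> Kw; rewrite /dist_tail indicE memNset ?mulr0//=.
by apply/negP; rewrite -ltNge.
Qed.

Lemma dist_tail_itv (w0 : T) (K : R) w : 0 <= dist_tail p w0 K w <= mdist w0 w `^ p.
Proof.
have [/dist_tail_ge ->|/dist_tail_lt ->] := leP K (mdist w0 w).
  by rewrite lexx powR_ge0.
by rewrite lexx powR_ge0.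
Qed.

(** Links the two ways of controlling moments: finiteness of one tail gives the
    p-th moment. *)
Lemma moment_le_tail (w0 : T) (K : R) w : 0 <= K ->
  mdist w0 w `^ p <= K `^ p + dist_tail p w0 K w.
Proof.
move=> K0; have [/dist_tail_ge ->|wK] := leP K (mdist w0 w).
  by rewrite lerDr powR_ge0.
rewrite dist_tail_lt// addr0.
by apply: ge0_ler_powR; rewrite ?nnegrE ?mdist_ge0 ?(ltW wK)//; exact: le_trans ler01 p1.
Qed.

Lemma measurable_moment (w0 : T) :
  measurable_fun setT ((fun w => mdist w0 w `^ p) : borel T -> R).
Proof. by apply: borel_measurable_continuous; exact: continuous_mdist_powR. Qed.

Lemma measurable_dist_tail (w0 : T) (K : R) :
  measurable_fun setT (dist_tail p w0 K : borel T -> R).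
Proof.
apply: measurable_funM; first exact: measurable_moment.
apply: measurable_indic.
rewrite (_ : [set x | _] = (mdist w0 : borel T -> R) @^-1` `[K, +oo[).
  rewrite -[_ @^-1` _]setTI.
  exact: (borel_measurable_continuous (@continuous_mdist R T w0)).
by apply/seteqP; split => x /=; rewrite in_itv/= andbT.
Qed.

Definition moment_under (mu : prob) :=
  forall w0 : T, integrable_under mu (fun w => mdist w0 w `^ p).

Lemma moment_under_tail mu (w0 : T) (K : R) :
  moment_under mu -> integrable_under mu (dist_tail p w0 K).
Proof.
move=> m; apply: (integrable_under_le _ (m w0)); first exact: measurable_dist_tail.
by move=> x; have /andP[? ?] := dist_tail_itv w0 K x; rewrite ger0_norm.
Qed.

(** The uniform tail condition bounds one tail by 1, hence the whole moment. *)
Lemma wasserstein_space_moment P mu : wasserstein_space p P -> P mu -> moment_under mu.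
Proof.
move=> [_ _ _ tP] Pmu w0.
have /ereal_cvg_finP/(_ _ ltr01)[K [_ KP]] := tP w0.
pose K1 := Num.max 0 K + 1.
have K1K : K < K1 by rewrite ltr_pwDr// le_max lexx orbT.
have K10 : 0 <= K1 by rewrite addr_ge0// le_max lexx.
have /andP[_ h] := KP _ K1K.
have itail : integrable_under mu (dist_tail p w0 K1).
  apply/integrableP; split; first by apply/measurable_EFinP; apply: measurable_dist_tail.
  rewrite (eq_integral (EFin \o (dist_tail p w0 K1 : borel T -> R))); last first.
    by move=> x _; rewrite /= ger0_norm//; case/andP: (dist_tail_itv w0 K1 x).
  apply: le_lt_trans (ltry (0 + 1)); apply: le_trans h.
  by apply: ereal_sup_ubound; exists mu.
apply: (@integrable_under_le _ _ _ _ (cst (K1 `^ p) \+ dist_tail p w0 K1)).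
- exact: measurable_moment.
- by apply: integrable_underD => //; exact: integrable_under_cst.
- by move=> x; rewrite ger0_norm ?powR_ge0//; exact: moment_le_tail.
Qed.

Lemma sublinE_tail_le P (w0 : T) (K e : R) : (forall mu, P mu -> moment_under mu) ->
  (sublinE P (dist_tail p w0 K) <= e%:E)%E <->
  forall mu, P mu -> expect mu (dist_tail p w0 K) <= e.
Proof.
move=> mP; split => [le mu Pmu|le].
  rewrite -lee_fin -integral_expect; last by apply: moment_under_tail; exact: mP.
  by apply: le_trans le; apply: ereal_sup_ubound; exists mu.
apply: ge_ereal_sup => _ [mu Pmu <-]; rewrite integral_expect ?lee_fin ?le//.
by apply: moment_under_tail; exact: mP.
Qed.

Lemma wasserstein_space_tail P (w0 : T) : wasserstein_space p P ->
  forall e : R, 0 < e -> exists2 K0 : R, 1 <= K0 & forall K, K0 <= K ->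
  forall mu, P mu -> expect mu (dist_tail p w0 K) <= e.
Proof.
move=> wP e e0; have [_ _ _ tP] := wP.
have /ereal_cvg_finP/(_ _ e0)[K [_ KP]] := tP w0.
exists (Num.max 1 (K + 1)); first by rewrite le_max lexx.
move=> K' KK'; apply/sublinE_tail_le; first by move=> mu; exact: wasserstein_space_moment.
have /andP[_] : ((0 - e)%:E <= sublinE P (dist_tail p w0 K') <= (0 + e)%:E)%E.
  by apply: KP; move: KK'; rewrite ge_max => /andP[_]; lra.
by rewrite add0r.
Qed.

(** The condition on the limit superior in (iii), with its quantifiers explicit. *)
Definition tails_vanish (Pn : nat -> set prob) (w0 : T) :=
  forall e : R, 0 < e -> exists2 K0 : R, 1 <= K0 & forall K, K0 <= K ->
  \forall n \near \oo, forall mu, Pn n mu -> expect mu (dist_tail p w0 K) <= e.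

Lemma limn_esup_tailP (Pn : nat -> set prob) (w0 : T) :
  (forall n, wasserstein_space p (Pn n)) ->
  limn_esup (fun n => sublinE (Pn n) (dist_tail p w0 K)) @[K --> +oo] --> 0%E <->
  tails_vanish Pn w0.
Proof.
move=> wPn.
have mP n mu : Pn n mu -> moment_under mu by exact: wasserstein_space_moment.
split => [/ereal_cvg_finP H e e0|H].
  have [|K [_ KP]] := H (e / 2); first by lra.
  exists (Num.max 1 (K + 1)); first by rewrite le_max lexx.
  move=> K'; rewrite ge_max => /andP[_ KK'].
  have /andP[_] := KP K' ltac:(lra).
  rewrite add0r => le.
  have /ereal_inf_lt[_ [A /= fA <-] Ae] :
      (limn_esup (fun n => sublinE (Pn n) (dist_tail p w0 K')) < e%:E)%E.
    by apply: le_lt_trans le _; rewrite lte_fin; lra.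
  apply: filterS fA => n An; apply/sublinE_tail_le; first exact: mP.
  by apply: le_trans (ltW Ae); apply: ereal_sup_ubound; exists n.
apply/ereal_cvg_finP => e e0; have [K0 K01 KP] := H e e0.
exists K0; split; first exact: num_real.
move=> K /ltW K0K; rewrite sub0r add0r; apply/andP; split; last first.
  apply: ge_ereal_inf; eexists; first by
    exists [set n | forall mu, Pn n mu -> expect mu (dist_tail p w0 K) <= e];
    [exact: (KP K K0K)|reflexivity].
  apply: ge_ereal_sup => _ [n /= nP <-]; apply/sublinE_tail_le => //; exact: mP.
apply: (@le_trans _ _ 0%E); first by rewrite lee_fin; lra.
apply: le_ereal_inf_tmp => _ [A /= [N _ NA] <-].
have [[mu Pmu] _ _ _] := wPn N.
apply: le_ereal_sup_tmp; exists (sublinE (Pn N) (dist_tail p w0 K)).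
  by exists N => //; exact: NA (leqnn N).
apply: le_ereal_sup_tmp; eexists; first by exists mu.
by apply: integral_ge0 => x _; rewrite lee_fin; case/andP: (dist_tail_itv w0 K x).
Qed.

End tails.

(** * Test functions of growth p *)

Section growth.
Context {R : realType} {T : polishMetricType R}.
Local Notation prob := (probability (borel T) R).
Implicit Types (mu nu : prob) (P : set prob) (phi psi : T -> R).
Variables (p : R) (p1 : 1 <= p).

Definition has_growth (phi : T -> R) :=
  exists (w1 : T) (C : R), forall w, `|phi w| <= C * (1 + mdist w1 w `^ p).

Lemma bounded_has_growth phi (M : R) : (forall x, `|phi x| <= M) -> has_growth phi.
Proof.
move=> phiM; exists point, M => w; apply: le_trans (phiM w) _.
by rewrite ler_peMr ?lerDl ?powR_ge0// (le_trans _ (phiM w)).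
Qed.

Lemma integrable_under_growth mu phi : moment_under p mu -> continuous phi ->
  has_growth phi -> integrable_under mu phi.
Proof.
move=> m cphi [w1 [C le]].
apply: (@integrable_under_le _ _ _ _
  (fun w => C * (cst 1 \+ (fun w => mdist w1 w `^ p)) w)) => //.
  exact: borel_measurable_continuous.
by apply: integrable_underZ; apply: integrable_underD => //; exact: integrable_under_cst.
Qed.

(** Makes the suprema over P finite, as [sublinE_cvgP] requires. *)
Lemma expect_growth_bounded P phi : wasserstein_space p P -> continuous phi ->
  has_growth phi -> exists M, forall mu, P mu -> expect mu phi <= M.
Proof.
move=> wP cphi [w1 [C le]].
have [K K1 KP] := wasserstein_space_tail p1 w1 wP ltr01.
exists (`|C| * (1 + (K `^ p + 1))) => mu Pmu.
have m := wasserstein_space_moment p1 wP Pmu.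
have it := moment_under_tail p1 w1 K m.
have ig : integrable_under mu (cst 1 \+ (cst (K `^ p) \+ dist_tail p w1 K)).
  by repeat apply: integrable_underD => //; exact: integrable_under_cst.
apply: (@le_trans _ _ (expect mu
    (fun w => `|C| * (cst 1 \+ (cst (K `^ p) \+ dist_tail p w1 K)) w))).
  apply: expect_le.
  - by apply: integrable_under_growth => //; exists w1, C.
  - exact: integrable_underZ.
  - move=> w /=; apply: le_trans (ler_norm _) _; apply: le_trans (le w) _.
    apply: (@le_trans _ _ (`|C| * (1 + mdist w1 w `^ p))).
      by rewrite ler_wpM2r ?ler_norm// addr_ge0 ?powR_ge0.
    by rewrite ler_wpM2l// lerD2l moment_le_tail//; lra.
rewrite expectZ// ler_wpM2l//.
rewrite expectD; [|exact: integrable_under_cst|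
  by apply: integrable_underD => //; exact: integrable_under_cst].
rewrite expectD//; last exact: integrable_under_cst.
by rewrite !expect_cst !lerD2l KP.
Qed.

Lemma sublinE_cvg_growthP (Pn : nat -> set prob) P phi :
  (forall n, wasserstein_space p (Pn n)) -> wasserstein_space p P ->
  continuous phi -> has_growth phi ->
  sublinE (Pn n) phi @[n --> \oo] --> sublinE P phi <->
  forall e : R, 0 < e ->
    \forall n \near \oo, dominated e phi (Pn n) P /\ dominated e phi P (Pn n).
Proof.
move=> wPn wP cphi gphi; have [M MP] := expect_growth_bounded wP cphi gphi.
apply: (@sublinE_cvgP _ _ _ _ _ M) => //.
- by move=> n; have [] := wPn n.
- by have [] := wP.
- move=> n mu Pmu; apply: integrable_under_growth => //.
  exact: (wasserstein_space_moment p1 (wPn n)).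
- move=> mu Pmu; apply: integrable_under_growth => //.
  exact: (wasserstein_space_moment p1 wP).
Qed.

Definition growth_cvg (Pn : nat -> set prob) P := forall phi : T -> R,
  continuous phi -> has_growth phi -> sublinE (Pn n) phi @[n --> \oo] --> sublinE P phi.

Lemma growth_cvg_weakly Pn P : growth_cvg Pn P -> sublinE_cvg_weakly Pn P.
Proof.
move=> H phi /bounded_continuousP[cphi [M MP]]; apply: H => //.
exact: bounded_has_growth MP.
Qed.

(** The tail function jumps at distance K; multiplying d^p by a continuous
    cut-off that rises from 0 to 1 on [K - 1, K] gives a continuous function
    between the tails of orders K and K - 1, to which the hypothesis applies. *)
Lemma growth_cvg_tails (Pn : nat -> set prob) P (w0 : T) :
  (forall n, wasserstein_space p (Pn n)) -> wasserstein_space p P ->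
  growth_cvg Pn P -> tails_vanish p Pn w0.
Proof.
move=> wPn wP H e e0; have e2 : 0 < e / 2 by lra.
have [K1 K11 KP] := wasserstein_space_tail p1 w0 wP e2.
exists (K1 + 1); first by lra.
move=> K KK; pose psi w := mdist w0 w `^ p * clamp ((1 - K) + 1 * mdist w0 w).
have psi_ge w : dist_tail p w0 K w <= psi w.
  have /andP[c0 c1] := clamp_itv ((1 - K) + 1 * mdist w0 w).
  have [wK|wK] := leP K (mdist w0 w); last first.
    by rewrite dist_tail_lt// mulr_ge0// powR_ge0.
  by rewrite dist_tail_ge// /psi clamp_ge1 ?mulr1//; lra.
have psi_le w : psi w <= dist_tail p w0 (K - 1) w.
  have /andP[c0 c1] := clamp_itv ((1 - K) + 1 * mdist w0 w).
  have [wK|wK] := leP (K - 1) (mdist w0 w).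
    by rewrite dist_tail_ge// /psi ler_piMr// powR_ge0.
  by rewrite dist_tail_lt// /psi clamp_le0 ?mulr0//; lra.
have cpsi : continuous psi.
  move=> w; apply: (@continuousM R T (fun w => mdist w0 w `^ p)).
    exact: continuous_mdist_powR.
  exact: continuous_clamp_mdist.
have gpsi : has_growth psi.
  exists w0, 1 => w; rewrite mul1r.
  have /andP[h1 h2] := dist_tail_itv p w0 K w.
  have /andP[h3 h4] := dist_tail_itv p w0 (K - 1) w.
  rewrite ger0_norm; first by have := psi_le w; lra.
  by have := psi_ge w; lra.
have ipsi mu : moment_under p mu -> integrable_under mu psi.
  by move=> m; exact: integrable_under_growth.
have := (sublinE_cvg_growthP wPn wP cpsi gpsi).1 (H _ cpsi gpsi) _ e2.
apply: filterS => n [dn _] mu Pmu.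
have mmu := wasserstein_space_moment p1 (wPn n) Pmu.
have [nu Pnu le] := dn _ Pmu.
have mnu := wasserstein_space_moment p1 wP Pnu.
have h1 : expect mu (dist_tail p w0 K) <= expect mu psi.
  by apply: expect_le => //; [exact: moment_under_tail|exact: ipsi].
have h2 : expect nu psi <= expect nu (dist_tail p w0 (K - 1)).
  by apply: expect_le => //; [exact: ipsi|exact: moment_under_tail].
have h3 : expect nu (dist_tail p w0 (K - 1)) <= e / 2 by apply: KP => //; lra.
by lra.
Qed.

(** Multiply phi by a continuous cut-off equal to 1 up to distance K and to 0
    after distance K + 1.  The product is bounded and continuous, and the error is
    at most a multiple of the tail of order K, which is uniformly small. *)
Lemma weak_tails_growth_cvg (Pn : nat -> set prob) P (w0 : T) :
  (forall n, wasserstein_space p (Pn n)) -> wasserstein_space p P ->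
  sublinE_cvg_weakly Pn P -> tails_vanish p Pn w0 -> growth_cvg Pn P.
Proof.
move=> wPn wP weak tails phi cphi gphi; apply/sublinE_cvg_growthP => // e e0.
have [w1 [C le]] := gphi.
(* For d(w0, w) >= 1 all terms of the growth bound are at most multiples of
   d(w0, w)^p; D collects the constants. *)
pose D := `|C| * (1 + 2 `^ p * (mdist w1 w0 `^ p + 1)).
have D0 : 0 <= D.
  by rewrite mulr_ge0// addr_ge0// mulr_ge0 ?powR_ge0// addr_ge0 ?powR_ge0.
have phi_tail w : 1 <= mdist w0 w -> `|phi w| <= D * mdist w0 w `^ p.
  move=> w01; have d1 : 1 <= mdist w0 w `^ p.
    have : 1 `^ p <= mdist w0 w `^ p.
      by apply: ge0_ler_powR; rewrite ?nnegrE ?mdist_ge0//; exact: le_trans ler01 p1.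
    by rewrite powR1.
  apply: le_trans (le w) _.
  apply: (@le_trans _ _ (`|C| * (1 + mdist w1 w `^ p))).
    by rewrite ler_wpM2r ?ler_norm// addr_ge0 ?powR_ge0.
  rewrite -mulrA ler_wpM2l//.
  have h : mdist w1 w `^ p <= 2 `^ p * (mdist w1 w0 `^ p + mdist w0 w `^ p).
    apply: le_trans (powRD_le _ _ _); rewrite ?mdist_ge0//; last exact: le_trans ler01 p1.
    apply: ge0_ler_powR; rewrite ?nnegrE ?addr_ge0 ?mdist_ge0//;
      first exact: le_trans ler01 p1.
    exact: metric_triangle.
  have a0 : 0 <= mdist w1 w0 `^ p by exact: powR_ge0.
  have b0 : 0 <= 2 `^ p :> R by exact: powR_ge0.
  apply: le_trans (lerD d1 h) _; rewrite mulrDl mul1r lerD2l -mulrA ler_wpM2l//.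
  by nra.
have d0 : 0 < e / (8 * (D + 1)) by rewrite divr_gt0// mulr_gt0//; lra.
have [K1 K11 KP1] := tails _ d0.
have [K2 K21 KP2] := wasserstein_space_tail p1 w0 wP d0.
pose K := Num.max K1 K2.
have K1K : K1 <= K by rewrite le_max lexx.
have K2K : K2 <= K by rewrite le_max lexx orbT.
pose chi w := clamp ((K + 1) + (- 1) * mdist w0 w).
pose psi w := phi w * chi w.
have cpsi : continuous psi.
  by move=> w; apply: (@continuousM R T phi); [exact: cphi|exact: continuous_clamp_mdist].
have bpsi : bounded_continuous psi.
  apply/bounded_continuousP; split => //.
  exists (`|C| * (1 + 2 `^ p * (mdist w1 w0 `^ p + (K + 1) `^ p))) => w.
  have /andP[c0 c1] := clamp_itv ((K + 1) + (- 1) * mdist w0 w).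
  have [wK|wK] := leP (mdist w0 w) (K + 1); last first.
    rewrite /psi /chi clamp_le0; last by lra.
    by rewrite mulr0 normr0 mulr_ge0// addr_ge0// mulr_ge0 ?powR_ge0// addr_ge0 ?powR_ge0.
  rewrite normrM (ger0_norm c0); apply: (@le_trans _ _ `|phi w|).
    by rewrite ler_piMr.
  apply: le_trans (le w) _.
  apply: (@le_trans _ _ (`|C| * (1 + mdist w1 w `^ p))).
    by rewrite ler_wpM2r ?ler_norm// addr_ge0 ?powR_ge0.
  rewrite ler_wpM2l// lerD2l.
  have p0 : 0 <= p by exact: le_trans ler01 p1.
  apply: (@le_trans _ _ ((mdist w1 w0 + (K + 1)) `^ p)).
    apply: ge0_ler_powR; rewrite ?nnegrE ?addr_ge0 ?mdist_ge0//; try lra.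
    by have := metric_triangle w1 w0 w; lra.
  by apply: powRD_le; rewrite ?mdist_ge0//; lra.
have close mu : moment_under p mu ->
    expect mu (dist_tail p w0 K) <= e / (8 * (D + 1)) ->
    `|expect mu phi - expect mu psi| <= e / 8.
  move=> m small; have it := moment_under_tail p1 w0 K m.
  apply: (@le_trans _ _ (expect mu (fun w => D * dist_tail p w0 K w))).
    apply: expect_dist_le.
    - exact: integrable_under_growth.
    - exact: integrable_under_bounded_continuous.
    - exact: integrable_underZ.
    - move=> w; rewrite /psi /chi.
      have /andP[c0 c1] := clamp_itv ((K + 1) + (- 1) * mdist w0 w).
      have [wK|wK] := leP K (mdist w0 w); last first.
        by rewrite clamp_ge1 ?mulr1 ?subrr ?normr0 ?dist_tail_lt ?mulr0//; lra.
      rewrite dist_tail_ge// (le_trans _ (phi_tail w _))//; last by lra.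
      rewrite -{1}[phi w]mulr1 -mulrBr normrM ler_piMr//.
      by rewrite ger0_norm; lra.
  rewrite expectZ//; apply: (@le_trans _ _ (D * (e / (8 * (D + 1))))).
    by rewrite ler_wpM2l.
  have -> : D * (e / (8 * (D + 1))) = (D / (D + 1)) * (e / 8) by field; lra.
  rewrite ler_piMl//; first by lra.
  by rewrite ler_pdivrMr; lra.
have e2 : 0 < e / 2 by lra.
have gpsi : has_growth psi.
  by have [_ [M psiM]] := (bounded_continuousP psi).1 bpsi; exact: bounded_has_growth psiM.
have dom := (sublinE_cvg_growthP wPn wP cpsi gpsi).1 (weak _ bpsi) _ e2.
apply: filterS2 dom (KP1 K K1K) => n [d1 d2] tn; split => mu Pmu.
  have [nu Pnu h] := d1 _ Pmu; exists nu => //.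
  have := close _ (wasserstein_space_moment p1 (wPn n) Pmu) (tn _ Pmu).
  have := close _ (wasserstein_space_moment p1 wP Pnu) (KP2 _ K2K _ Pnu).
  by rewrite !ler_norml => /andP[? ?] /andP[? ?]; lra.
have [nu Pnu h] := d2 _ Pmu; exists nu => //.
have := close _ (wasserstein_space_moment p1 wP Pmu) (KP2 _ K2K _ Pmu).
have := close _ (wasserstein_space_moment p1 (wPn n) Pnu) (tn _ Pnu).
by rewrite !ler_norml => /andP[? ?] /andP[? ?]; lra.
Qed.

End growth.

(** * Transport of integrals along couplings *)

Section coupling_transfer.
Context {R : realType} {T : polishMetricType R}.
Local Notation prob := (probability (borel T) R).
Implicit Types (mu nu : prob) (P : set prob) (f g : T -> R).

Section law.
Context d (S : measurableType d) (Q : probability S R) (X : {mfun S >-> borel T}).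

Lemma ge0_integral_law mu (f : borel T -> \bar R) : has_law Q X mu ->
  measurable_fun setT f -> (forall x, 0 <= f x)%E ->
  (\int[Q]_s f (X s) = \int[mu]_x f x)%E.
Proof.
move=> law mf f0; have := ge0_integral_distribution (P := Q) X mf f0.
rewrite /comp => <-; apply: eq_measure_integral => A mA _; exact: law.
Qed.

Lemma integrable_law mu f : has_law Q X mu -> integrable_under mu f ->
  Q.-integrable setT (EFin \o (f \o X)).
Proof.
move=> law /integrableP[mf intf]; apply/integrableP; split.
  by apply: (measurableT_comp mf); exact: measurable_funPT.
rewrite (ge0_integral_law (f := fun x => `|(f x)%:E|%E) law)//.
exact: measurableT_comp.
Qed.

Lemma Rintegral_law mu f : has_law Q X mu -> integrable_under mu f ->
  (\int[Q]_s f (X s))%R = expect mu f.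
Proof.
move=> law intf; congr fine; have /integrableP[mf _] := intf.
have := integral_distribution (P := Q) (X := X) mf (integrable_law law intf).
rewrite /comp => <-; apply: eq_measure_integral => A mA _; exact: law.
Qed.

End law.

Variables (p : R) (p1 : 1 <= p).

(** The transport cost itself, before the p-th root, is what estimates use. *)
Definition coupled (c : R) mu nu :=
  exists (d : measure_display) (S : measurableType d)
      (Q : probability S R) (X Y : {mfun S >-> borel T}),
    [/\ has_law Q X mu, has_law Q Y nu &
        (\int[Q]_s ((mdist (X s : T) (Y s : T)) `^ p)%:E < c%:E)%E].

Lemma coupled_sym c mu nu : coupled c mu nu -> coupled c nu mu.
Proof.
move=> [d [S [Q [X [Y [lX lY le]]]]]]; exists d, S, Q, Y, X.
split; [exact: lY|exact: lX|].
by under eq_integral do rewrite metric_sym.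
Qed.

(** A distance below c^(1/p) is witnessed by a coupling of cost below c, since
    the infimum is approached. *)
Lemma wasserstein_dist_coupled c mu nu : 0 < c ->
  (wasserstein_dist p mu nu < (c `^ p^-1)%:E)%E -> coupled c mu nu.
Proof.
move=> c0 /ereal_inf_lt[r [d [S [Q [X [Y [lX lY ->]]]]]] lt].
exists d, S, Q, X, Y; split => //; rewrite ltNge; apply: contraTN lt => le.
rewrite -leNgt -poweR_EFin.
have c0' : (0 <= c%:E)%E by rewrite lee_fin ltW.
apply: gt0_ler_poweR => //.
- by rewrite invr_ge0; exact: le_trans ler01 p1.
- by rewrite in_itv/= c0' leey.
- by rewrite in_itv/= (le_trans c0' le) leey.
Qed.

(** The only way in which couplings are used to compare expectations: integrate
    f(X) <= g(Y) + a d(X, Y)^p + b. *)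
Lemma coupled_expect_le c mu nu f g (a b : R) : 0 <= a ->
  coupled c mu nu -> integrable_under mu f -> integrable_under nu g ->
  (forall x y, f x <= g y + (a * mdist x y `^ p + b)) ->
  expect mu f <= expect nu g + (a * c + b).
Proof.
move=> a0 [d [S [Q [X [Y [lX lY le]]]]]] intf intg fg.
rewrite -(Rintegral_law lX intf) -(Rintegral_law lY intg).
have mD : measurable_fun setT (fun s => mdist (X s : T) (Y s : T) `^ p).
  apply: (@measurableT_comp _ _ _ _ _ _ (@powR R ^~ p)) => //.
  by apply: measurable_mdist; exact: measurable_funPT.
have iD : Q.-integrable setT (EFin \o (fun s => mdist (X s : T) (Y s : T) `^ p)).
  apply/integrableP; split; first exact/measurable_EFinP.
  under eq_integral do rewrite /= ger0_norm ?powR_ge0//.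
  by apply: lt_trans le _; rewrite ltry.
have iaD : Q.-integrable setT (EFin \o (fun s => a * mdist (X s : T) (Y s : T) `^ p)).
  by have := integrableZl measurableT a iD.
have ib : Q.-integrable setT (EFin \o (cst b : S -> R)).
  exact: finite_measure_integrable_cst.
have iX := integrable_law lX intf; have iY := integrable_law lY intg.
have iaDb := integrableD measurableT iaD ib.
apply: (@le_trans _ _ (\int[Q]_s (g (Y s) + (a * mdist (X s : T) (Y s : T) `^ p + b)))%R).
  by apply: le_Rintegral => //; have := integrableD measurableT iY iaDb.
rewrite RintegralD// lerD2l RintegralD// RintegralZl//.
rewrite Rintegral_cst// [X in b * fine X](_ : _ = 1%E); last exact: probability_setT.
rewrite mulr1 lerD2r ler_wpM2l// -lee_fin.
by rewrite /Rintegral fineK ?ltW//; exact: integrable_fin_num iD.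
Qed.

(** Both suprema in the distance are small, so every measure on either side has a
    partner on the other side at small cost. *)
Lemma gen_wasserstein_coupled (Pn : nat -> set prob) P :
  gen_wasserstein_dist p (Pn n) P @[n --> \oo] --> 0%E ->
  forall c : R, 0 < c -> \forall n \near \oo,
    (forall mu, Pn n mu -> exists2 nu, P nu & coupled c mu nu) /\
    (forall nu, P nu -> exists2 mu, Pn n mu & coupled c nu mu).
Proof.
move=> /ereal_cvg_finP H c c0.
have c'0 : 0 < c `^ p^-1 by exact: powR_gt0.
have c'2 : 0 < c `^ p^-1 / 2 by lra.
apply: filterS (H _ c'2) => n /andP[_]; rewrite add0r => le.
have {le} : (gen_wasserstein_dist p (Pn n) P < (c `^ p^-1)%:E)%E.
  by apply: le_lt_trans le _; rewrite lte_fin; lra.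
rewrite gt_max => /andP[lt1 lt2]; split.
  move=> mu Pmu.
  have /ereal_inf_lt[_ [nu Pnu <-]] :
      (ereal_inf [set wasserstein_dist p mu nu | nu in P] < (c `^ p^-1)%:E)%E.
    by apply: le_lt_trans lt1; apply: ereal_sup_ubound; exists mu.
  by move=> /(wasserstein_dist_coupled c0); exists nu.
move=> nu Pnu.
have /ereal_inf_lt[_ [mu Pmu <-]] :
    (ereal_inf [set wasserstein_dist p mu nu | mu in Pn n] < (c `^ p^-1)%:E)%E.
  by apply: le_lt_trans lt2; apply: ereal_sup_ubound; exists nu.
by move=> /(wasserstein_dist_coupled c0) h; exists mu => //; exact: coupled_sym.
Qed.

(** If x is at distance at least 2K from w0, then either d(x, y) is at most half
    that distance and y is still at distance at least K, or d(x, y) is at least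
    half that distance. *)
Lemma dist_tail_coupling (w0 : T) (K : R) x y : 0 <= K ->
  dist_tail p w0 (2 * K) x <=
  2 `^ p * dist_tail p w0 K y + (2 `^ p * mdist x y `^ p + 0).
Proof.
move=> K0; have p0 : 0 <= p by exact: le_trans ler01 p1.
have /andP[t0 _] := dist_tail_itv p w0 K y.
have c0 : 0 <= 2 `^ p :> R by exact: powR_ge0.
have d0 : 0 <= mdist x y `^ p by exact: powR_ge0.
have [xK|xK] := leP (2 * K) (mdist w0 x); last first.
  by rewrite dist_tail_lt// addr0 addr_ge0// mulr_ge0.
rewrite dist_tail_ge// addr0.
have [near|far] := leP (mdist x y) (mdist w0 x / 2).
  have tri := metric_triangle w0 y x; rewrite (metric_sym y x) in tri.
  apply: ler_wpDr; first by rewrite mulr_ge0.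
  rewrite dist_tail_ge; last by lra.
  rewrite -powRM ?mdist_ge0//.
  by apply: ge0_ler_powR; rewrite ?nnegrE ?mulr_ge0 ?mdist_ge0//; lra.
apply: ler_wpDl; first by rewrite mulr_ge0.
rewrite -powRM ?mdist_ge0//.
by apply: ge0_ler_powR; rewrite ?nnegrE ?mulr_ge0 ?mdist_ge0//; lra.
Qed.

Lemma wasserstein_cvg_tails (Pn : nat -> set prob) P (w0 : T) :
  (forall n, wasserstein_space p (Pn n)) -> wasserstein_space p P ->
  gen_wasserstein_dist p (Pn n) P @[n --> \oo] --> 0%E -> tails_vanish p Pn w0.
Proof.
move=> wPn wP H e e0; have c0 : 0 < 2 `^ p :> R by exact: powR_gt0.
have e'0 : 0 < e / (2 * 2 `^ p) by rewrite divr_gt0// mulr_gt0.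
have [K1 K11 KP] := wasserstein_space_tail p1 w0 wP e'0.
exists (2 * K1); first by lra.
move=> K KK; have := gen_wasserstein_coupled H e'0.
apply: filterS => n [cn _] mu Pmu; have [nu Pnu cpl] := cn _ Pmu.
have itmu := moment_under_tail p1 w0 K (wasserstein_space_moment p1 (wPn n) Pmu).
have itnu := moment_under_tail p1 w0 (K / 2) (wasserstein_space_moment p1 wP Pnu).
have := coupled_expect_le (ltW c0) cpl itmu (integrable_underZ (2 `^ p) itnu) (b := 0).
rewrite expectZ// addr0 => h; apply: le_trans (h _) _.
  move=> x y; have := @dist_tail_coupling w0 (K / 2) x y.
  by rewrite (_ : 2 * (K / 2) = K); [apply; lra|by field].
have -> : 2 `^ p * (e / (2 * 2 `^ p)) = e / 2 by field; lra.
have : expect nu (dist_tail p w0 (K / 2)) <= e / (2 * 2 `^ p) by apply: KP => //; lra.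
rewrite -(ler_pM2l c0).
have -> : 2 `^ p * (e / (2 * 2 `^ p)) = e / 2 by field; lra.
by lra.
Qed.

End coupling_transfer.

(** * Wasserstein convergence implies weak convergence *)

Section sup_convolution.
Context {R : realType} {T : polishMetricType R}.
Local Notation prob := (probability (borel T) R).
Implicit Types (mu nu : prob) (P : set prob).

(** The sup-convolution of phi with k times the distance: the least k-Lipschitz
    function above phi. *)
Definition sup_conv (phi : T -> R) (k : R) (y : T) : R :=
  sup [set phi x - k * mdist x y | x in setT].

Variables (phi : T -> R) (M : R) (phiM : forall x, `|phi x| <= M).

Let term_le k x y : 0 <= k -> phi x - k * mdist x y <= M.
Proof.
move=> k0; have := phiM x; rewrite ler_norml => /andP[_ h].
have := mdist_ge0 x y; nra.
Qed.

Let has_sup_term k y : 0 <= k -> has_sup [set phi x - k * mdist x y | x in setT].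
Proof.
move=> k0; split; first by exists (phi y - k * mdist y y), y.
by exists M => _ [x _ <-]; exact: term_le.
Qed.

Lemma sup_conv_ge k x y : 0 <= k -> phi x <= sup_conv phi k y + k * mdist x y.
Proof.
move=> k0; rewrite -lerBlDr; apply: ub_le_sup; last by exists x.
by have [] := has_sup_term y k0.
Qed.

Lemma sup_conv_le k y c : 0 <= k -> (forall x, phi x <= c + k * mdist x y) ->
  sup_conv phi k y <= c.
Proof.
move=> k0 H; apply: ge_sup; first by have [] := has_sup_term y k0.
by move=> _ [x _ <-]; rewrite lerBlDr.
Qed.

Lemma sup_conv_norm k y : 0 <= k -> `|sup_conv phi k y| <= M.
Proof.
move=> k0; rewrite ler_norml; apply/andP; split.
  have := sup_conv_ge y y k0; rewrite mdistxx mulr0 addr0.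
  by apply: le_trans; have := phiM y; rewrite ler_norml => /andP[].
by apply: sup_conv_le => // x; rewrite -lerBlDr term_le.
Qed.

Lemma sup_conv_continuous k : 0 <= k -> continuous (sup_conv phi k).
Proof.
move=> k0; apply: (lipschitz_continuous k0).
suff H y z : sup_conv phi k y <= sup_conv phi k z + k * mdist y z.
  move=> y z; rewrite ler_distl lerBlDr H andbT.
  by rewrite metric_sym H.
apply: sup_conv_le => // x; apply: le_trans (sup_conv_ge x z k0) _.
by rewrite -addrA lerD2l -mulrDr ler_wpM2l// addrC metric_triangle.
Qed.

Lemma sup_conv_nonincreasing k l y : 0 <= k -> k <= l -> sup_conv phi l y <= sup_conv phi k y.
Proof.
move=> k0 kl; apply: sup_conv_le; first exact: le_trans kl.
move=> x; apply: le_trans (sup_conv_ge x y k0) _.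
by rewrite lerD2l ler_wpM2r// mdist_ge0.
Qed.

(** Points x far from y are penalised by k d(x, y), which exceeds the oscillation
    2M of phi for k large; near y continuity of phi decides. *)
Lemma sup_conv_cvg y : continuous phi -> sup_conv phi n%:R y @[n --> \oo] --> phi y.
Proof.
move=> cphi; apply/cvgrPdist_le => e e0.
have /cvgrPdist_le/(_ _ e0)/metricType_numDomainType.nbhs_mdistP[r /= r0 near_y] := cphi y.
exists (Num.truncn (2 * M / r)).+1 => // n /= Nn.
have nM : 2 * M / r <= n%:R.
  by apply: le_trans (ltW (truncnS_gt _)) _; rewrite ler_nat.
rewrite ler_distlC; apply/andP; split.
  by have := sup_conv_ge y y (ler0n R n); rewrite mdistxx mulr0 addr0; lra.
apply: sup_conv_le => // x; have [xr|xr] := ltP (mdist y x) r.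
  have := near_y _ xr; rewrite /= ler_distl => /andP[h _].
  have : 0 <= n%:R * mdist x y :> R by rewrite mulr_ge0// mdist_ge0.
  by lra.
have h1 : 2 * M <= n%:R * mdist x y.
  move: nM; rewrite ler_pdivrMr// => /le_trans; apply.
  by rewrite metric_sym ler_wpM2l.
by have := phiM x; have := phiM y; rewrite !ler_norml => /andP[? ?] /andP[? ?]; lra.
Qed.

End sup_convolution.

Section wasserstein_cvg_weakly.
Context {R : realType} {T : polishMetricType R}.
Local Notation prob := (probability (borel T) R).
Implicit Types (mu nu : prob) (P : set prob).
Variables (p : R) (p1 : 1 <= p).

(** Replaces Hoelder's inequality in passing from a cost of order p to a cost of
    order 1.  If d(x, y) > d, then d(x, y) / d >= 1 is below its p-th power. *)
Lemma mdist_le_powR (x y : T) (d : R) : 0 < d ->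
  mdist x y <= d * (d^-1 `^ p) * mdist x y `^ p + d.
Proof.
move=> d0; have c0 : 0 <= d * (d^-1 `^ p) * mdist x y `^ p.
  by rewrite !mulr_ge0 ?powR_ge0// ltW.
have [xd|xd] := leP (mdist x y) d; first by rewrite ler_wpDl.
apply: ler_wpDr; first exact: ltW.
have d'0 : 0 <= d^-1 by rewrite invr_ge0 ltW.
rewrite -mulrA -powRM ?mdist_ge0// -ler_pdivrMl//.
by apply: le1r_powR => //; rewrite mulrC ler_pdivlMr// mul1r ltW.
Qed.

(** One measure nu0 of P nearly maximises E phi, and Dini's theorem gives a k
    for which E phi^k on P does not exceed E_nu0 phi by more than e / 2.  The
    coupling then costs k E d(X, Y), which is small once c is. *)
Lemma coupled_sup_conv P (phi : T -> R) : P !=set0 -> weakly_compact P ->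
  bounded_continuous phi -> forall e : R, 0 < e ->
  exists2 c : R, 0 < c & exists2 nu0, P nu0 &
    forall mu nu, P nu -> coupled p c mu nu -> expect mu phi <= expect nu0 phi + e.
Proof.
move=> P0 cP bphi e e0; have [cphi [M MP]] := (bounded_continuousP phi).1 bphi.
have bsc (k : nat) : bounded_continuous (sup_conv phi k%:R).
  apply/bounded_continuousP; split; first exact: sup_conv_continuous MP _ _.
  by exists M => x; exact: sup_conv_norm.
have e2 : 0 < e / 2 by lra.
have [k [nu0 Pnu0 le]] : exists k : nat, exists2 nu, P nu & forall mu, P mu ->
    expect mu (sup_conv phi k%:R) <= expect nu phi + e / 2.
  apply: (dini_compact P0 cP bsc bphi _ _ e2) => [k x|x].
    by apply: sup_conv_nonincreasing MP _ _ _ _ _ => //; rewrite ler_nat.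
  exact: sup_conv_cvg MP _ _.
have k0 : 0 <= k%:R :> R by [].
(* With d(X, Y) <= d + d^(1-p) d(X, Y)^p the cost k E d(X, Y) splits into k d
   and a c; both are made at most e / 4. *)
pose d := e / (4 * (k%:R + 1)); have d0 : 0 < d by rewrite divr_gt0// mulr_gt0//; lra.
pose a := k%:R * (d * (d^-1 `^ p)).
have a0 : 0 <= a by rewrite !mulr_ge0 ?powR_ge0// ltW.
exists (e / (4 * (a + 1))); first by rewrite divr_gt0// mulr_gt0//; lra.
exists nu0 => // mu nu Pnu cpl.
have := coupled_expect_le a0 cpl (integrable_under_bounded_continuous mu bphi)
  (integrable_under_bounded_continuous nu (bsc k)) (b := k%:R * d).
move=> h; apply: le_trans (h _) _.
  move=> x y; apply: le_trans (sup_conv_ge MP x y k0) _.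
  by rewrite lerD2l /a -mulrA -mulrDr ler_wpM2l//; exact: mdist_le_powR.
have h1 : a * (e / (4 * (a + 1))) <= e / 4.
  have -> : a * (e / (4 * (a + 1))) = (a / (a + 1)) * (e / 4) by field; lra.
  by rewrite ler_piMl//; [lra|rewrite ler_pdivrMr; lra].
have h2 : k%:R * d <= e / 4.
  have -> : k%:R * d = (k%:R / (k%:R + 1)) * (e / 4) by rewrite /d; field; lra.
  by rewrite ler_piMl//; [lra|rewrite ler_pdivrMr; lra].
by have := le _ Pnu; lra.
Qed.

(** Domination of [Pn n] by [P] is the previous lemma.  For the converse, a
    nearly optimal nu2 of [P] is fixed, and the previous lemma is applied to the
    compact set {nu2} and to - phi. *)
Lemma wasserstein_cvg_weakly (Pn : nat -> set prob) P :
  (forall n, wasserstein_space p (Pn n)) -> wasserstein_space p P ->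
  gen_wasserstein_dist p (Pn n) P @[n --> \oo] --> 0%E -> sublinE_cvg_weakly Pn P.
Proof.
move=> wPn wP H phi bphi; have [P0 _ cP _] := wP.
have [cphi [M MP]] := (bounded_continuousP phi).1 bphi.
apply/(sublinE_cvg_growthP p1 wPn wP cphi (bounded_has_growth p MP)) => e e0.
have e2 : 0 < e / 2 by lra.
have [c1 c10 [nu1 Pnu1 le1]] := coupled_sup_conv P0 cP bphi e0.
have iphi mu := integrable_under_bounded_continuous mu bphi.
have [nu2 Pnu2 sup2] : exists2 nu, P nu &
    forall mu, P mu -> expect mu phi <= expect nu phi + e / 2.
  apply: (@near_sup R T P phi M) => // mu Pmu; rewrite -(expect_cst mu M).
  apply: expect_le => //; first exact: integrable_under_cst.
  by move=> x; exact: le_trans (ler_norm _) (MP x).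
have bNphi : bounded_continuous (fun x => (- 1) * phi x).
  apply/bounded_continuousP; split.
    by move=> x; apply: (@continuousM R T (cst (- 1))); [exact: cst_continuous|exact: cphi].
  by exists M => x; rewrite normrM normrN1 mul1r.
have [c2 c20 [nu2' -> le2]] := coupled_sup_conv (ex_intro _ nu2 erefl)
  (@compact_set1 (@weak_prob R T) nu2) bNphi e2.
have c0 : 0 < Num.min c1 c2 by rewrite lt_min c10.
apply: filterS (gen_wasserstein_coupled p1 H c0) => n [d1 d2].
have weaken c mu nu : Num.min c1 c2 <= c -> coupled p (Num.min c1 c2) mu nu ->
    coupled p c mu nu.
  move=> le [d [S [Q [X [Y [lX lY lt]]]]]]; exists d, S, Q, X, Y; split => //.
  by apply: lt_le_trans lt _; rewrite lee_fin.
split => mu Pmu.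
  exists nu1 => //; have [nu Pnu cpl] := d1 _ Pmu.
  by apply: le1 Pnu _; apply: weaken cpl; rewrite ge_min lexx.
have [nu Pnu cpl] := d2 _ Pnu2; exists nu => //.
have := le2 nu nu2 erefl (coupled_sym (weaken c2 _ _ _ cpl)).
rewrite ge_min lexx orbT !expectZ// => /(_ isT).
by have := sup2 _ Pmu; lra.
Qed.

End wasserstein_cvg_weakly.

(** * Separation of convex sets in finite dimension *)

Section separation.
Context {R : realType}.

Definition dot {m} (a v : 'I_m -> R) : R := \sum_i a i * v i.

(** Mass vectors live in the unit cube, which bounds all the distances that occur
    in the separation argument. *)
Definition in_cube {m} (v : 'I_m -> R) := forall i, 0 <= v i <= 1.

Definition convex_vectors {m} (V : set ('I_m -> R)) :=
  forall v w (t : R), V v -> V w -> 0 <= t <= 1 ->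
  V (fun i => t * v i + (1 - t) * w i).

(** The separating direction is x - v where v almost minimises the distance from
    x to V.  Comparing v with the points t w + (1 - t) v of V gives
    2 t <x - v, w - v> <= k + t^2 |w - v|^2, where k is the defect of
    minimality; t and then k are taken small with respect to d^2. *)
Lemma approx_projection_separates m (V : set ('I_m -> R)) (x : 'I_m -> R) (d : R) :
  0 < d -> V !=set0 -> convex_vectors V -> V `<=` in_cube ->
  (forall v, V v -> exists i, d <= `|x i - v i|) ->
  exists2 v, V v & forall w, V w ->
    dot (fun i => x i - v i) w <= dot (fun i => x i - v i) x - d ^+ 2 / 2.
Proof.
move=> d0 [v0 Vv0] cV VC far.
have d20 : 0 < d ^+ 2 by rewrite exprn_gt0.
(* t m <= d^2 / 2 absorbs the quadratic term, as |w - v|^2 <= m in the cube. *)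
pose t := Num.min 1 (d ^+ 2 / (2 * (m%:R + 1))).
have m0 : 0 <= m%:R :> R by [].
have t0 : 0 < t by rewrite lt_min ltr01 divr_gt0// mulr_gt0//; lra.
have t1 : t <= 1 by rewrite ge_min lexx.
have tm : t * m%:R <= d ^+ 2 / 2.
  have le : t <= d ^+ 2 / (2 * (m%:R + 1)) by rewrite ge_min lexx orbT.
  apply: le_trans (ler_wpM2r m0 le) _.
  have -> : d ^+ 2 / (2 * (m%:R + 1)) * m%:R = (m%:R / (m%:R + 1)) * (d ^+ 2 / 2).
    by field; lra.
  by rewrite ler_piMl//; [lra|rewrite ler_pdivrMr; lra].
pose dist2 (v : 'I_m -> R) := \sum_i (x i - v i) ^+ 2.
have lb : has_lbound [set dist2 v | v in V].
  by exists 0 => _ [v _ <-]; apply: sumr_ge0 => i _; exact: sqr_ge0.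
have hinf : has_inf [set dist2 v | v in V] by split => //; exists (dist2 v0), v0.
have k0 : 0 < t * d ^+ 2 / 2 by rewrite divr_gt0// mulr_gt0.
have [_ [v Vv <-] vinf] := inf_adherent k0 hinf.
exists v => // w Vw.
have Vu := cV w v t Vw Vv ltac:(by rewrite (ltW t0)).
have := ge_inf lb (ex_intro2 _ _ _ Vu erefl).
pose B := \sum_i (x i - v i) * (w i - v i).
pose C := \sum_i (w i - v i) ^+ 2.
have -> : dist2 (fun i => t * w i + (1 - t) * v i) = dist2 v - 2 * t * B + t ^+ 2 * C.
  rewrite /dist2 /B /C !mulr_sumr -sumrB -big_split/=.
  by apply: eq_bigr => i _; ring.
have Cm : C <= m%:R.
  rewrite -[m in m%:R]card_ord -sumr_const; apply: ler_sum => i _.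
  have /andP[? ?] := VC _ Vv i; have /andP[? ?] := VC _ Vw i.
  rewrite -[leRHS](expr1n _ 2) -ler_sqrt ?expr1n ?ltr01// sqrtr_sqr sqrtr1.
  by rewrite ler_norml; lra.
have A1 : d ^+ 2 <= dist2 v.
  have [i di] := far _ Vv; rewrite /dist2 (bigD1 i)//=.
  apply: ler_wpDr; first by apply: sumr_ge0 => j _; exact: sqr_ge0.
  by rewrite -[leRHS]real_normK ?num_real// lerXn2r// nnegrE ?normr_ge0// ltW.
move=> inf_le.
have tC : t ^+ 2 * C <= t * (d ^+ 2 / 2).
  rewrite expr2 -mulrA ler_wpM2l ?(ltW t0)//; apply: le_trans tm.
  by rewrite ler_wpM2l ?(ltW t0).
have {inf_le} BB : t * B <= t * (d ^+ 2 / 2) by lra.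
have {}BB : B <= d ^+ 2 / 2 by move: BB; rewrite ler_pM2l.
have -> : dot (fun i => x i - v i) w = dot (fun i => x i - v i) v + B.
  by rewrite /dot /B -big_split/=; apply: eq_bigr => i _; ring.
have -> : dot (fun i => x i - v i) x = dot (fun i => x i - v i) v + dist2 v.
  by rewrite /dot /dist2 -big_split/=; apply: eq_bigr => i _; ring.
by lra.
Qed.

(** The net is a grid of mesh h, indexed by a finite type so that finitely many
    convergences can be combined. *)
Lemma cube_net m (h : R) : 0 < h -> exists (J : finType) (dir : J -> 'I_m -> R),
  forall a : 'I_m -> R, (forall i, `|a i| <= 1) ->
  exists j, forall i, `|a i - dir j i| <= h.
Proof.
move=> h0; pose N := Num.truncn (2 / h).
exists {ffun 'I_m -> 'I_N.+1},
  (fun (j : {ffun 'I_m -> 'I_N.+1}) i => - 1 + h * (j i : nat)%:R) => a a1.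
exists [ffun i => inord (Num.truncn ((a i + 1) / h))] => i.
rewrite ffunE inordK; last first.
  rewrite ltnS; apply: le_truncn; rewrite ler_pM2r ?invr_gt0//.
  by have := a1 i; rewrite ler_norml => /andP[_]; lra.
have ai0 : 0 <= (a i + 1) / h.
  by apply: divr_ge0; [have := a1 i; rewrite ler_norml => /andP[]; lra|exact: ltW].
have /andP[] := truncn_itv ai0; rewrite ler_pdivlMr// ltr_pdivrMr//.
set k := Num.truncn _; rewrite -natr1 => h1 h2.
by rewrite ler_norml; apply/andP; split; lra.
Qed.

(** If x is far from V, some direction of the cube separates them with margin
    d^2 / 2.  Moving that direction by h in each coordinate changes both sides by
    at most m h, so the nearest direction of a fine enough net still separates. *)
Lemma finitely_many_directions m (d : R) : 0 < d ->
  exists (J : finType) (dir : J -> 'I_m -> R), exists2 e : R, 0 < e &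
  forall (V : set ('I_m -> R)) (x : 'I_m -> R),
  V !=set0 -> convex_vectors V -> V `<=` in_cube -> in_cube x ->
  (forall j, exists2 w, V w & dot (dir j) x <= dot (dir j) w + e) ->
  exists2 w, V w & forall i, `|x i - w i| <= d.
Proof.
move=> d0; have d20 : 0 < d ^+ 2 by rewrite exprn_gt0.
have m0 : 0 <= m%:R :> R by [].
pose h := d ^+ 2 / (8 * (m%:R + 1)).
have h0 : 0 < h by rewrite divr_gt0// mulr_gt0//; lra.
have [J [dir net]] := cube_net m h0.
exists J, dir, (d ^+ 2 / 8); first by lra.
move=> V x V0 cV VC xC H; apply: contrapT => /forall2NP no.
have [v Vv sep] : exists2 v, V v & forall w, V w ->
    dot (fun i => x i - v i) w <= dot (fun i => x i - v i) x - d ^+ 2 / 2.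
  apply: approx_projection_separates => // v Vv.
  have [//|/existsNP[i /negP]] := no v; rewrite -ltNge => /ltW di.
  by exists i.
have [|j near] := net (fun i => x i - v i).
  move=> i; have /andP[? ?] := xC i; have /andP[? ?] := VC _ Vv i.
  by rewrite ler_norml; lra.
have approx u : in_cube u -> `|dot (fun i => x i - v i) u - dot (dir j) u| <= m%:R * h.
  move=> uC; rewrite /dot -sumrB; apply: le_trans (ler_norm_sum _ _ _) _.
  rewrite mulr_natl -[m in _ *+ m]card_ord -sumr_const; apply: ler_sum => i _.
  rewrite -mulrBl normrM; have /andP[u0 u1] := uC i.
  rewrite (ger0_norm u0); apply: le_trans (near i).
  by rewrite ler_piMr.
have [w Vw le] := H j.
have mh : m%:R * h <= d ^+ 2 / 8.
  have -> : m%:R * h = (m%:R / (m%:R + 1)) * (d ^+ 2 / 8) by rewrite /h; field; lra.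
  by rewrite ler_piMl//; [lra|rewrite ler_pdivrMr; lra].
have := sep _ Vw; have := approx _ xC; have := approx _ (VC _ Vw).
by rewrite !ler_norml => /andP[? ?] /andP[? ?]; lra.
Qed.

End separation.

(** * Partitions of unity by small bumps *)

Section partition_of_unity.
Context {R : realType} {T : polishMetricType R}.

(** With q a dense sequence and u_i a bump that is 1 on the ball B(q_i, r) and 0
    off B(q_i, 2r), take psi_k = prod_(i < k) (1 - u_i).  The differences
    psi_k - psi_(k+1) = psi_k u_k are supported in B(q_k, 2r), and psi_k(w)
    vanishes as soon as some q_i with i < k is within r of w. *)
Lemma bump_sequence (r : R) : 0 < r ->
  exists psi : nat -> T -> R,
  [/\ forall k, continuous (psi k), forall w, psi 0%N w = 1,
      forall k w, 0 <= psi k.+1 w <= psi k w,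
      forall w, psi k w @[k --> \oo] --> 0 &
      forall k x y, psi k x != psi k.+1 x -> psi k y != psi k.+1 y ->
        mdist x y <= 4 * r].
Proof.
move=> r0; have [q qd] := @dense_sequence R T.
have r'0 : 0 < r^-1 by rewrite invr_gt0.
pose u i w := clamp (2 + (- r^-1) * mdist (q i) w).
pose psi k w := \prod_(i < k) (1 - u i w).
have psiS k w : psi k.+1 w = psi k w * (1 - u k w) by rewrite /psi big_ord_recr.
have psi0 k w : 0 <= psi k w.
  by apply: prodr_ge0 => i _; have /andP[] := clamp_itv (2 + (- r^-1) * mdist (q i) w);
    rewrite /u; lra.
have dec k w : 0 <= psi k.+1 w <= psi k w.
  rewrite psi0 psiS ler_piMr//.
  by have /andP[] := clamp_itv (2 + (- r^-1) * mdist (q k) w); rewrite /u; lra.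
exists psi; split => //.
- elim=> [|k IH] w.
    rewrite (_ : psi 0%N = cst 1); first exact: cst_continuous.
    by apply/funext => z; rewrite /psi big_ord0.
  rewrite (_ : psi k.+1 = (fun w => psi k w * (1 - u k w))); last by apply/funext => z.
  apply: (@continuousM R T (psi k)); first exact: IH.
  apply: (@continuousB R R^o T (cst 1)); first exact: cst_continuous.
  exact: continuous_clamp_mdist.
- by move=> w; rewrite /psi big_ord0.
- move=> w; have [i qi] := qd w _ r0.
  have eq0 k : (i < k)%N -> psi k w = 0.
    move=> ik; rewrite /psi (bigD1 (Ordinal ik))//= /u clamp_ge1 ?subrr ?mul0r//.
    have : r^-1 * mdist (q i) w <= 1 by rewrite mulrC ler_pdivrMr// mul1r ltW.
    by lra.
  apply/cvgrPdist_le => e e0; exists i.+1 => // k /= ik.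
  by rewrite eq0// subrr normr0 ltW.
- have near k x : psi k x != psi k.+1 x -> mdist (q k) x <= 2 * r.
    rewrite psiS; apply: contraNT; rewrite -ltNge => far.
    rewrite /u clamp_le0 ?subr0 ?mulr1//.
    have : 2 <= r^-1 * mdist (q k) x by rewrite mulrC ler_pdivlMr// ltW.
    by lra.
  move=> k x y /near xk /near yk.
  by have := metric_triangle x (q k) y; rewrite (metric_sym x (q k)); lra.
Qed.

End partition_of_unity.

(** * Probabilities with a density *)

Section density.
Local Open Scope ereal_scope.
Context d (S : measurableType d) (R : realType).
Variable (m : probability S R) (h : S -> R).

(** The hypotheses on h are arguments so that the probability structure can be
    attached to the measure. *)
Definition density_measure of measurable_fun setT h & (forall z, (0 <= h z)%R) &
  \int[m]_z (h z)%:E = 1 := fun A : set S => \int[m]_(z in A) (h z)%:E.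

Variables (mh : measurable_fun setT h) (h0 : forall z, (0 <= h z)%R)
  (h1 : \int[m]_z (h z)%:E = 1).

Local Notation density := (density_measure mh h0 h1).

Let density0 : density set0 = 0.
Proof. exact: integral_set0. Qed.

Let density_ge0 A : 0 <= density A.
Proof. by apply: integral_ge0 => z _; rewrite lee_fin. Qed.

Let density_sigma_additive : semi_sigma_additive density.
Proof.
move=> /= F mF tF mUF; rewrite /density_measure; apply: cvg_toP.
  apply: ereal_nondecreasing_is_cvgn => k l kl.
  apply: lee_sum_nneg_natr => // i _ _.
  by apply: integral_ge0 => z _; rewrite lee_fin.
rewrite ge0_integral_bigcup//=.
- by apply: measurable_funTS; exact/measurable_EFinP.
- by move=> z _; rewrite lee_fin.
Qed.

HB.instance Definition _ := isMeasure.Build _ _ _ density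
  density0 density_ge0 density_sigma_additive.

HB.instance Definition _ := @Measure_isProbability.Build _ _ R density h1.

(** By uniqueness, h is almost everywhere the Radon-Nikodym derivative of the
    measure that it defines, for which the change of variables is known. *)
Lemma integral_density (f : S -> \bar R) : measurable_fun setT f -> (forall z, 0 <= f z) ->
  \int[density]_z f z = \int[m]_z (f z * (h z)%:E).
Proof.
move=> mf f0; have dom : density `<< m.
  apply/null_content_dominatesP => A mA mA0.
  by apply: null_set_integral => //; apply: measurable_funTS; exact/measurable_EFinP.
rewrite -(Radon_Nikodym_SigmaFinite.change_of_variables dom)//.
have ih : m.-integrable setT (EFin \o h).
  apply/integrableP; split; first exact/measurable_EFinP.
  under eq_integral do rewrite /= ger0_norm//.
  by rewrite h1 ltry.
have mRN := measurable_int _ (Radon_Nikodym_SigmaFinite.f_integrable dom).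
apply: ae_eq_integral => //.
- exact: emeasurable_funM.
- by apply: emeasurable_funM => //; exact/measurable_EFinP.
- apply: filterS (integral_ae_eq measurableT (Radon_Nikodym_SigmaFinite.f_integrable dom)
    (measurable_int _ ih) _).
    by move=> z H zT; rewrite /= H.
  by move=> A _ mA; rewrite -Radon_Nikodym_SigmaFinite.f_integral.
Qed.

End density.

(** * Couplings with a density *)

Section density_product.
Local Open Scope ereal_scope.

(** A density on a product whose partial integrals are all 1 defines a coupling of
    the two factors, by Tonelli's theorem. *)
Lemma density_product_coupling d1 d2 (T1 : measurableType d1) (T2 : measurableType d2)
    (R : realType) (P1 : probability T1 R) (P2 : probability T2 R)
    (h : T1 * T2 -> R) :
  measurable_fun setT h -> (forall z, (0 <= h z)%R) ->
  (forall x, \int[P2]_y (h (x, y))%:E = 1) ->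
  (forall y, \int[P1]_x (h (x, y))%:E = 1) ->
  exists Q : probability (T1 * T2)%type R,
  [/\ forall A, measurable A -> Q (fst @^-1` A) = P1 A,
      forall B, measurable B -> Q (snd @^-1` B) = P2 B &
      forall f : T1 * T2 -> \bar R, measurable_fun setT f -> (forall z, 0 <= f z) ->
        \int[Q]_z f z = \int[P1 \x P2]_z (f z * (h z)%:E)].
Proof.
move=> mh h0 hr hl.
have mEh : measurable_fun setT (EFin \o h) by exact/measurable_EFinP.
have h1 : \int[P1 \x P2]_z (h z)%:E = 1.
  rewrite (fubini_tonelli1 (EFin \o h))//.
  rewrite (eq_integral (cst 1)); last by move=> x _; exact: hr.
  by rewrite integral_cst// mul1e; exact: probability_setT.
pose m : probability (T1 * T2)%type R := P1 \x P2.
have m1 : \int[m]_z (h z)%:E = 1 by exact: h1.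
pose Q : probability (T1 * T2)%type R := density_measure mh h0 m1.
have QE (f : T1 * T2 -> \bar R) : measurable_fun setT f -> (forall z, 0 <= f z) ->
  \int[Q]_z f z = \int[P1 \x P2]_z (f z * (h z)%:E) by exact: (integral_density mh h0 m1).
have Qindic (A : set (T1 * T2)) : measurable A ->
    Q A = \int[P1 \x P2]_z ((\1_A z)%:E * (h z)%:E).
  move=> mA; rewrite -QE//; first by rewrite integral_indic// setIT.
  exact/measurable_EFinP.
have mprod (A : set (T1 * T2)) : measurable A ->
    measurable_fun setT (fun z => (\1_A z)%:E * (h z)%:E).
  by move=> mA; apply: emeasurable_funM => //; exact/measurable_EFinP.
have prod0 (A : set (T1 * T2)) z : 0 <= (\1_A z)%:E * (h z)%:E.
  by rewrite mule_ge0// lee_fin.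
exists Q; split => //.
- move=> A mA; have mfA : measurable (@fst T1 T2 @^-1` A).
    by rewrite -[_ @^-1` _]setTI; exact: measurable_fst.
  rewrite Qindic//.
  rewrite (fubini_tonelli1 (fun z => (\1_(fst @^-1` A) z)%:E * (h z)%:E))//; last first.
    exact: mprod.
  transitivity (\int[P1]_x (\1_A x)%:E); last by rewrite integral_indic// setIT.
  apply: eq_integral => x _; rewrite /fubini_F.
  transitivity (\int[P2]_y ((\1_A x)%:E * (h (x, y))%:E)) => //.
  rewrite ge0_integralZl ?hr ?mule1//.
    by apply/measurable_EFinP; exact: (measurableT_comp mh).
  by move=> y _; rewrite lee_fin.
- move=> A mA; have mfA : measurable (@snd T1 T2 @^-1` A).
    by rewrite -[_ @^-1` _]setTI; exact: measurable_snd.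
  rewrite Qindic//.
  rewrite (fubini_tonelli1 (fun z => (\1_(snd @^-1` A) z)%:E * (h z)%:E))//; last first.
    exact: mprod.
  rewrite (fubini_tonelli (fun z => (\1_(snd @^-1` A) z)%:E * (h z)%:E))//; last first.
    exact: mprod.
  transitivity (\int[P2]_y (\1_A y)%:E); last by rewrite integral_indic// setIT.
  apply: eq_integral => y _; rewrite /fubini_G.
  transitivity (\int[P1]_x ((\1_A y)%:E * (h (x, y))%:E)) => //.
  rewrite ge0_integralZl ?hl ?mule1//.
    by apply/measurable_EFinP; exact: (measurableT_comp mh).
  by move=> x _; rewrite lee_fin.
Qed.

End density_product.

Section density_coupled.
Context {R : realType} {T : polishMetricType R}.
Local Notation prob := (probability (borel T) R).
Implicit Types (mu nu : prob).
Local Notation TT := (borel T * borel T)%type.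

Lemma density_coupled (p c : R) mu nu (h : TT -> R) :
  measurable_fun setT h -> (forall z, 0 <= h z) ->
  (forall x, \int[nu]_y (h (x, y))%:E = 1)%E ->
  (forall y, \int[mu]_x (h (x, y))%:E = 1)%E ->
  (\int[mu \x nu]_z (mdist (z.1 : T) (z.2 : T) `^ p * h z)%:E < c%:E)%E ->
  coupled p c mu nu.
Proof.
move=> mh h0 hnu hmu cost.
have [Q [Q1 Q2 QE]] := density_product_coupling mh h0 hnu hmu.
pose X : {mfun TT >-> borel T} := MeasurableFun.Pack (MeasurableFun.Class
  (isMeasurableFun.Build _ _ _ _ _ (@measurable_fst _ _ (borel T) (borel T)))).
pose Y : {mfun TT >-> borel T} := MeasurableFun.Pack (MeasurableFun.Class
  (isMeasurableFun.Build _ _ _ _ _ (@measurable_snd _ _ (borel T) (borel T)))).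
exists _, TT, Q, X, Y; split => //.
rewrite QE.
- by under eq_integral do rewrite -EFinM.
- apply/measurable_EFinP; apply: (@measurableT_comp _ _ _ _ _ _ (@powR R ^~ p)) => //.
  by apply: measurable_mdist; [exact: measurable_fst|exact: measurable_snd].
- by move=> z; rewrite lee_fin powR_ge0.
Qed.

End density_coupled.

(** * Coupling two measures along a partition of unity *)

Section partition_coupling.
Context {R : realType} {T : polishMetricType R}.
Local Notation prob := (probability (borel T) R).
Implicit Types (mu nu : prob).
Local Notation TT := (borel T * borel T)%type.

Lemma measurable_continuous_fst (g : T -> R) : continuous g ->
  measurable_fun setT (fun z : TT => g z.1).
Proof.
move=> cg; apply: (@measurableT_comp _ _ _ _ _ _ (g : borel T -> R)).
  exact: borel_measurable_continuous.
exact: measurable_fst.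
Qed.

Lemma measurable_continuous_snd (g : T -> R) : continuous g ->
  measurable_fun setT (fun z : TT => g z.2).
Proof.
move=> cg; apply: (@measurableT_comp _ _ _ _ _ _ (g : borel T -> R)).
  exact: borel_measurable_continuous.
exact: measurable_snd.
Qed.

Lemma integrable_under_sum mu (I : Type) (s : seq I) (k : I -> R) (f : I -> T -> R) :
  (forall i, integrable_under mu (f i)) ->
  integrable_under mu (fun x => \sum_(i <- s) k i * f i x).
Proof.
move=> intf; elim: s => [|i s IH].
  rewrite (_ : (fun _ => _) = cst 0); first exact: integrable_under_cst.
  by apply/funext => x; rewrite big_nil.
rewrite (_ : (fun _ => _) = (fun x => k i * f i x) \+ (fun x => \sum_(j <- s) k j * f j x)).
  by apply: integrable_underD => //; exact: integrable_underZ.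
by apply/funext => x; rewrite big_cons.
Qed.

Lemma expect_sum mu (I : Type) (s : seq I) (k : I -> R) (f : I -> T -> R) :
  (forall i, integrable_under mu (f i)) ->
  expect mu (fun x => \sum_(i <- s) k i * f i x) = \sum_(i <- s) k i * expect mu (f i).
Proof.
move=> intf; elim: s => [|i s IH].
  rewrite big_nil (_ : (fun _ => _) = cst 0) ?expect_cst//.
  by apply/funext => x; rewrite big_nil.
rewrite (_ : (fun _ => _) = (fun x => k i * f i x) \+ (fun x => \sum_(j <- s) k j * f j x)).
  rewrite expectD ?expectZ ?IH ?big_cons//; first exact: integrable_underZ.
  exact: integrable_under_sum.
by apply/funext => x; rewrite big_cons.
Qed.

Lemma continuous_sum (I : Type) (s : seq I) (k : I -> R) (f : I -> T -> R) :
  (forall i, continuous (f i)) -> continuous (fun x => \sum_(i <- s) k i * f i x).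
Proof.
move=> cf; elim: s => [|i s IH].
  rewrite (_ : (fun _ => _) = cst 0); first exact: cst_continuous.
  by apply/funext => x; rewrite big_nil.
rewrite (_ : (fun _ => _) = (fun x => k i * f i x + \sum_(j <- s) k j * f j x)).
  move=> x; apply: (@continuousD R R^o T (fun x => k i * f i x)); last exact: IH.
  by apply: (@continuousM R T (cst (k i))); [exact: cst_continuous|exact: cf].
by apply/funext => x; rewrite big_cons.
Qed.

Section leftover.
Variables (m : nat) (f : 'I_m -> T -> R) (c : 'I_m -> R).
Hypothesis (cf : forall i, continuous (f i)) (f0 : forall i x, 0 <= f i x)
  (f1 : forall x, \sum_i f i x <= 1) (c0 : forall i, 0 <= c i).

(** If part i keeps the mass c_i, the proportion c_i / E f_i of f_i mu is used up,
    and [leftover mu] is the density of what remains.  When E f_i = 0 the quotient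
    is 0 by the convention on inverses, which is consistent as c_i = 0 then. *)
Definition leftover (mu : prob) (x : T) : R :=
  1 - \sum_i c i / expect mu (f i) * f i x.

Lemma bounded_continuous_part i : bounded_continuous (f i).
Proof.
apply/bounded_continuousP; split => //; exists 1 => x; rewrite ger0_norm//.
by apply: le_trans (f1 x); rewrite (bigD1 i)//= lerDl; apply: sumr_ge0.
Qed.

Variable mu : prob.
Hypothesis cmu : forall i, c i <= expect mu (f i).

Let intf i : integrable_under mu (f i).
Proof. exact/integrable_under_bounded_continuous/bounded_continuous_part. Qed.

Lemma part_weight_ge0 i : 0 <= c i / expect mu (f i).
Proof. by rewrite divr_ge0//; exact: le_trans (cmu i). Qed.

(** Valid for E f_i = 0 as well, because then c_i = 0. *)
Lemma part_weightK i : c i / expect mu (f i) * expect mu (f i) = c i.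
Proof.
have [e0|?] := eqVneq (expect mu (f i)) 0; last by rewrite divfK.
by rewrite e0 mulr0; apply/eqP; rewrite eq_le c0 -e0 cmu.
Qed.

Lemma leftover_itv x : 0 <= leftover mu x <= 1.
Proof.
rewrite /leftover subr_ge0 lerBlDr lerDl; apply/andP; split; last first.
  by apply: sumr_ge0 => i _; rewrite mulr_ge0// part_weight_ge0.
apply: le_trans (f1 x); apply: ler_sum => i _; rewrite ler_piMl//.
have [e0|e0] := eqVneq (expect mu (f i)) 0; first by rewrite e0 invr0 mulr0.
rewrite ler_pdivrMr ?mul1r// lt_neqAle eq_sym e0.
exact: le_trans (cmu i).
Qed.

Lemma continuous_leftover : continuous (leftover mu).
Proof.
move=> x; apply: (@continuousB R R^o T (cst 1)); first exact: cst_continuous.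
exact: continuous_sum.
Qed.

Lemma integrable_under_leftover : integrable_under mu (leftover mu).
Proof.
apply: integrable_under_bounded_continuous; apply/bounded_continuousP; split.
  exact: continuous_leftover.
by exists 1 => x; have /andP[? ?] := leftover_itv x; rewrite ger0_norm.
Qed.

Lemma expect_leftover : expect mu (leftover mu) = 1 - \sum_i c i.
Proof.
rewrite [LHS](_ : _ = expect mu (cst 1 \- (fun x => \sum_i c i / expect mu (f i) * f i x)))//.
rewrite expectB ?expect_cst ?expect_sum//; last 2 first.
- exact: integrable_under_cst.
- exact: integrable_under_sum.
by congr (_ - _); apply: eq_bigr => i _; exact: part_weightK.
Qed.

Lemma integrable_under_moment_leftover p w0 : 1 <= p -> moment_under p mu ->
  integrable_under mu (fun x => mdist w0 x `^ p * leftover mu x).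
Proof.
move=> p1 mom; apply: (integrable_under_le _ (mom w0)).
  apply: borel_measurable_continuous => x.
  apply: (@continuousM R T (fun x => mdist w0 x `^ p)); last exact: continuous_leftover.
  exact: continuous_mdist_powR.
move=> x; have /andP[g0 g1] := leftover_itv x.
by rewrite ger0_norm ?mulr_ge0 ?powR_ge0// ler_piMr// powR_ge0.
Qed.

(** Inside the ball of radius K the moment is at most K^p, and the leftover has
    total mass 1 - sum_i c_i; outside, the leftover density is at most 1. *)
Lemma expect_moment_leftover p w0 K : 1 <= p -> 0 <= K -> moment_under p mu ->
  expect mu (fun x => mdist w0 x `^ p * leftover mu x) <=
  K `^ p * (1 - \sum_i c i) + expect mu (dist_tail p w0 K).
Proof.
move=> p1 K0 mom; rewrite -expect_leftover.
have it := moment_under_tail p1 w0 K mom.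
have il := integrable_under_leftover.
rewrite -expectZ// -expectD//; last exact: integrable_underZ.
apply: expect_le; first exact: integrable_under_moment_leftover.
  by apply: integrable_underD => //; exact: integrable_underZ.
move=> x /=; have /andP[g0 g1] := leftover_itv x.
have /andP[t0 _] := dist_tail_itv p w0 K x.
apply: le_trans (ler_wpM2r g0 (moment_le_tail p1 w0 x K0)) _.
by rewrite mulrDl lerD2l ler_piMr.
Qed.

End leftover.

Section density.
Variables (m : nat) (f : 'I_m -> T -> R) (c : 'I_m -> R).
Hypothesis (cf : forall i, continuous (f i)) (f0 : forall i x, 0 <= f i x)
  (f1 : forall x, \sum_i f i x <= 1) (c0 : forall i, 0 <= c i)
  (c1 : \sum_i c i < 1).

(** Density, with respect to the product of mu and nu, of the coupling that moves
    the mass c_i from f_i mu to f_i nu independently, and couples the two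
    leftovers independently. *)
Definition glue_density mu nu (x y : T) : R :=
  \sum_i c i / (expect mu (f i) * expect nu (f i)) * f i x * f i y +
  leftover f c mu x * leftover f c nu y / (1 - \sum_i c i).

Lemma glue_density_sym mu nu x y : glue_density mu nu x y = glue_density nu mu y x.
Proof.
rewrite /glue_density; congr (_ + _); last by rewrite [X in X / _]mulrC.
by apply: eq_bigr => i _; rewrite [expect mu _ * _]mulrC -!mulrA [f i x * _]mulrC.
Qed.

Section two_measures.
Variables mu nu : prob.
Hypothesis (cmu : forall i, c i <= expect mu (f i))
  (cnu : forall i, c i <= expect nu (f i)).

Let eta0 : 0 < 1 - \sum_i c i. Proof. by rewrite subr_gt0. Qed.

Let weight_ge0 i : 0 <= c i / (expect mu (f i) * expect nu (f i)).
Proof. by rewrite divr_ge0// mulr_ge0//; apply: le_trans (c0 i) _. Qed.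

Lemma glue_density_ge0 x y : 0 <= glue_density mu nu x y.
Proof.
rewrite addr_ge0//.
  by apply: sumr_ge0 => i _; do 2 apply: mulr_ge0 => //; exact: weight_ge0.
have /andP[? _] := leftover_itv f0 f1 c0 cmu x.
have /andP[? _] := leftover_itv f0 f1 c0 cnu y.
by rewrite divr_ge0 ?mulr_ge0// ltW.
Qed.

Let glueE x : glue_density mu nu x =
  (fun y => \sum_i (c i / (expect mu (f i) * expect nu (f i)) * f i x) * f i y) \+
  (fun y => leftover f c mu x / (1 - \sum_i c i) * leftover f c nu y).
Proof. by apply/funext => y; rewrite /glue_density /= [X in _ + X]mulrAC. Qed.

Let intf i : integrable_under nu (f i).
Proof.
by apply: integrable_under_bounded_continuous; apply: bounded_continuous_part.
Qed.

Lemma integrable_under_glue x : integrable_under nu (glue_density mu nu x).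
Proof.
rewrite glueE; apply: integrable_underD; first exact: integrable_under_sum.
by apply: integrable_underZ; exact: integrable_under_leftover.
Qed.

(** The second marginal of the density: each product term integrates to
    c_i / E_mu f_i times f_i x, and the leftover term to the leftover of mu, and
    these add up to 1. *)
Lemma expect_glue x : expect nu (glue_density mu nu x) = 1.
Proof.
rewrite glueE expectD; last 2 first.
- exact: integrable_under_sum.
- by apply: integrable_underZ; exact: integrable_under_leftover.
rewrite expectZ; last exact: integrable_under_leftover.
rewrite expect_leftover// divfK ?gt_eqF// expect_sum// /leftover.
rewrite [X in X + _](_ : _ = \sum_i c i / expect mu (f i) * f i x).
  by rewrite addrC subrK.
apply: eq_bigr => i _; rewrite -[in RHS](part_weightK c0 cnu i) invfM.
by ring.
Qed.

Lemma measurable_glue :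
  measurable_fun setT (fun z : TT => glue_density mu nu z.1 z.2).
Proof.
apply: measurable_funD.
  apply: measurable_sum => i; apply: measurable_funM; last exact: measurable_continuous_snd.
  by apply: measurable_funM => //; exact: measurable_continuous_fst.
apply: measurable_funM => //; apply: measurable_funM.
  by apply: measurable_continuous_fst; exact: continuous_leftover.
by apply: measurable_continuous_snd; exact: continuous_leftover.
Qed.

End two_measures.

(** On the support of the part i the distance is at most s, which costs s^p in
    total.  The leftovers are coupled through w0, with
    d(x, y)^p <= 2^p (d(w0, x)^p + d(w0, y)^p). *)
Lemma partition_coupled (p : R) mu nu (s K : R) (w0 : T) (b : R) : 1 <= p ->
  (forall i, c i <= expect mu (f i)) -> (forall i, c i <= expect nu (f i)) ->
  moment_under p mu -> moment_under p nu -> 0 <= s -> 0 <= K ->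
  (forall i x y, f i x != 0 -> f i y != 0 -> mdist x y <= s) ->
  s `^ p + 2 `^ p * (K `^ p * (1 - \sum_i c i) + expect mu (dist_tail p w0 K) +
    (K `^ p * (1 - \sum_i c i) + expect nu (dist_tail p w0 K))) < b ->
  coupled p b mu nu.
Proof.
move=> p1 cmu cnu mommu momnu s0 K0 near lt; have p0 : 0 <= p by exact: le_trans ler01 p1.
set eta := 1 - \sum_i c i in lt *; have eta0 : 0 < eta by rewrite subr_gt0.
set gm := leftover f c mu; set gn := leftover f c nu.
have gm_itv x : 0 <= gm x <= 1 by exact: leftover_itv.
have gn_itv x : 0 <= gn x <= 1 by exact: leftover_itv.
pose h (z : TT) := glue_density mu nu z.1 z.2.
have h0 z : 0 <= h z by exact: glue_density_ge0.
have mh : measurable_fun setT h by exact: measurable_glue.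
pose B (x y : T) := s `^ p * glue_density mu nu x y + 2 `^ p *
  ((mdist w0 x `^ p * gm x / eta) * gn y + (gm x / eta) * (mdist w0 y `^ p * gn y)).
have hB x y : mdist x y `^ p * glue_density mu nu x y <= B x y.
  have /andP[gx0 _] := gm_itv x; have /andP[gy0 _] := gn_itv y.
  have d2 : mdist x y `^ p <= 2 `^ p * (mdist w0 x `^ p + mdist w0 y `^ p).
    apply: le_trans (powRD_le _ _ _); rewrite ?mdist_ge0//.
    apply: ge0_ler_powR; rewrite ?nnegrE ?addr_ge0 ?mdist_ge0//.
    by rewrite (metric_sym w0 x); exact: metric_triangle.
  rewrite /B [X in _ * X]/glue_density mulrDr; apply: lerD.
    apply: (@le_trans _ _ (s `^ p *
        \sum_i c i / (expect mu (f i) * expect nu (f i)) * f i x * f i y)).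
      rewrite !mulr_sumr; apply: ler_sum => i _.
      have w0' : 0 <= c i / (expect mu (f i) * expect nu (f i)).
        by rewrite divr_ge0// mulr_ge0//; apply: le_trans (c0 i) _.
      have [->|fx] := eqVneq (f i x) 0; first by rewrite mulr0 mul0r !mulr0.
      have [->|fy] := eqVneq (f i y) 0; first by rewrite !mulr0.
      apply: ler_wpM2r; first by do 2 apply: mulr_ge0 => //.
      by apply: ge0_ler_powR; rewrite ?nnegrE ?mdist_ge0//; exact: near fx fy.
    rewrite ler_wpM2l ?powR_ge0// lerDl divr_ge0 ?mulr_ge0//; exact: ltW.
  rewrite -/gm -/gn -/eta.
  apply: le_trans (ler_wpM2r _ d2) _; first by rewrite divr_ge0 ?mulr_ge0// ltW.
  by rewrite le_eqVlt; apply/orP; left; apply/eqP; ring.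
have B0 x y : 0 <= B x y by apply: le_trans (hB x y); rewrite mulr_ge0 ?powR_ge0// (h0 (x, y)).
have cgm : continuous gm by exact: continuous_leftover.
have cgn : continuous gn by exact: continuous_leftover.
have cw := @continuous_mdist_powR R T p w0 p1.
have mB : measurable_fun setT (fun z : TT => B z.1 z.2).
  apply: measurable_funD; first exact: measurable_funM.
  apply: measurable_funM => //; apply: measurable_funD.
    apply: measurable_funM; last exact: (measurable_continuous_snd cgn).
    apply: measurable_funM => //; apply: measurable_funM;
      last exact: (measurable_continuous_fst cgm).
    exact: (measurable_continuous_fst cw).
  apply: measurable_funM.
    by apply: measurable_funM => //; exact: (measurable_continuous_fst cgm).
  by apply: measurable_funM;
    [exact: (measurable_continuous_snd cw)|exact: (measurable_continuous_snd cgn)].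
have ign : integrable_under nu gn by exact: integrable_under_leftover.
have igm : integrable_under mu gm by exact: integrable_under_leftover.
have ingn : integrable_under nu (fun y => mdist w0 y `^ p * gn y).
  exact: integrable_under_moment_leftover.
have ingm : integrable_under mu (fun y => mdist w0 y `^ p * gm y).
  exact: integrable_under_moment_leftover.
have egn : expect nu gn = eta by exact: expect_leftover.
have egm : expect mu gm = eta by exact: expect_leftover.
set Gn := expect nu (fun y => mdist w0 y `^ p * gn y).
set Gm := expect mu (fun y => mdist w0 y `^ p * gm y).
have igl x : integrable_under nu (glue_density mu nu x) by exact: integrable_under_glue.
have i1 x : integrable_under nu (fun y => s `^ p * glue_density mu nu x y).
  exact: integrable_underZ.
have i2 x := integrable_underZ (mdist w0 x `^ p * gm x / eta) ign.
have i3 x := integrable_underZ (gm x / eta) ingn.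
have i4 x := integrable_underZ (2 `^ p) (integrable_underD (i2 x) (i3 x)).
have iB x : integrable_under nu (B x) by exact: integrable_underD (i1 x) (i4 x).
have eB x : expect nu (B x) =
    s `^ p + 2 `^ p * (mdist w0 x `^ p * gm x + Gn / eta * gm x).
  transitivity (expect nu ((fun y => s `^ p * glue_density mu nu x y) \+
    (fun y => 2 `^ p * ((fun y => (mdist w0 x `^ p * gm x / eta) * gn y) \+
      (fun y => (gm x / eta) * (mdist w0 y `^ p * gn y))) y))) => //.
  rewrite expectD// !expectZ//; last exact: integrable_underD (i2 x) (i3 x).
  rewrite expect_glue// expectD// !expectZ// egn -/Gn mulr1 divfK ?gt_eqF//.
  by congr (_ + _ * (_ + _)); ring.
have cost : (\int[mu \x nu]_z (B z.1 z.2)%:E =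
    (s `^ p + 2 `^ p * (Gm + Gn))%:E)%E.
  rewrite (fubini_tonelli1 (fun z : TT => (B z.1 z.2)%:E)); last 2 first.
  - exact/measurable_EFinP.
  - by move=> z; rewrite lee_fin.
  transitivity (\int[mu]_x (s `^ p +
      2 `^ p * (mdist w0 x `^ p * gm x + Gn / eta * gm x))%:E)%E.
    by apply: eq_integral => x _; rewrite /fubini_F -eB; exact: integral_expect (iB x).
  have j1 := integrable_underZ (Gn / eta) igm.
  have j2 := integrable_underZ (2 `^ p) (integrable_underD ingm j1).
  have j3 := integrable_underD (integrable_under_cst mu (s `^ p)) j2.
  rewrite (integral_expect j3); congr EFin.
  rewrite expectD//; last exact: integrable_under_cst.
  rewrite expect_cst expectZ; last exact: integrable_underD.
  by rewrite expectD// expectZ// egm divfK ?gt_eqF.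
apply: (@density_coupled _ _ p b mu nu h) => //.
- by move=> x; rewrite (integral_expect (igl x)) expect_glue.
- move=> y; under eq_integral do rewrite /h/= glue_density_sym.
  by rewrite (integral_expect (integrable_under_glue _ _ _)) ?expect_glue.
- apply: (@le_lt_trans _ _ (s `^ p + 2 `^ p * (Gm + Gn))%:E); last first.
    rewrite lte_fin; apply: le_lt_trans lt; rewrite lerD2l ler_wpM2l ?powR_ge0//.
    by apply: lerD; exact: expect_moment_leftover.
  rewrite -cost; apply: ge0_le_integral => //.
  + by move=> z _; rewrite lee_fin mulr_ge0 ?powR_ge0.
  + apply/measurable_EFinP; apply: measurable_funM => //.
    apply: (@measurableT_comp _ _ _ _ _ _ (@powR R ^~ p)) => //.
    by apply: measurable_mdist; [exact: measurable_fst|exact: measurable_snd].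
  + exact/measurable_EFinP.
  + by move=> z _; rewrite lee_fin; exact: hB.
Qed.

End density.

End partition_coupling.

(** * Weak convergence with vanishing tails implies Wasserstein convergence *)

Section matching.
Context {R : realType} {T : polishMetricType R}.
Local Notation prob := (probability (borel T) R).
Implicit Types (mu nu rho : prob) (P Q : set prob).

(** Convexity of a set of measures is stated through values on Borel sets; this
    is the corresponding statement on integrals. *)
Lemma expect_mixture mu nu rho (t : R) (f : T -> R) : 0 <= t <= 1 ->
  (forall A, measurable A -> rho A = (t%:E * mu A + (1 - t)%:E * nu A)%E) ->
  bounded_continuous f -> (forall x, 0 <= f x) ->
  expect rho f = t * expect mu f + (1 - t) * expect nu f.
Proof.
move=> /andP[t0 t1] rhoE bf f0; have t1' : 0 <= 1 - t by rewrite subr_ge0.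
have intf m := integral_expect (integrable_under_bounded_continuous m bf).
apply: EFin_inj; rewrite EFinD !EFinM -!intf.
have mf : measurable_fun setT (fun x : borel T => (f x)%:E).
  by apply/measurable_EFinP; apply: borel_measurable_continuous; exact: bf.1.
rewrite (eq_measure_integral (measure_add (mscale (NngNum t0) mu) (mscale (NngNum t1') nu))).
  rewrite ge0_integral_measure_add//; last by move=> x _; rewrite lee_fin.
  by rewrite !ge0_integral_mscale//; move=> x _; rewrite lee_fin.
move=> A mA _; apply: etrans (rhoE A mA) _; apply/esym.
exact: (measure_addE (mscale (NngNum t0) mu) (mscale (NngNum t1') nu)).
Qed.

Variables (m : nat) (f : 'I_m -> T -> R).
Hypothesis (bf : forall i, bounded_continuous (f i)) (f01 : forall i x, 0 <= f i x <= 1).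

Let moments mu : 'I_m -> R := fun i => expect mu (f i).

Let intf i mu : integrable_under mu (f i).
Proof. exact: integrable_under_bounded_continuous. Qed.

Let moments_cube mu : in_cube (moments mu).
Proof.
move=> i; rewrite -{1}(expect_cst mu 0) -[X in _ <= _ <= X](expect_cst mu 1).
by apply/andP; split; apply: expect_le => //; try exact: integrable_under_cst;
  move=> x; case/andP: (f01 i x).
Qed.

Let moments_convex P : convex_probs P -> convex_vectors [set moments mu | mu in P].
Proof.
move=> cP _ _ t [mu Pmu <-] [nu Pnu <-] t01.
have [rho Prho rhoE] := cP mu nu t Pmu Pnu t01.
exists rho => //; apply/funext => i; apply: (expect_mixture t01 rhoE) => // x.
by case/andP: (f01 i x).
Qed.

(** The vectors of the E f_i over a convex set of measures form a convex subset of
    the cube, and its support function in the direction a is the sublinear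
    expectation of sum_i a_i f_i.  Convergence in the finitely many directions of
    [finitely_many_directions] is what matching needs, in both directions. *)
Lemma weak_cvg_matches_parts (Pn : nat -> set prob) P (d : R) : 0 < d ->
  (forall n, Pn n !=set0) -> (forall n, convex_probs (Pn n)) ->
  P !=set0 -> convex_probs P -> sublinE_cvg_weakly Pn P ->
  \forall n \near \oo,
    (forall mu, Pn n mu -> exists2 nu, P nu &
      forall i, `|expect mu (f i) - expect nu (f i)| <= d) /\
    (forall mu, P mu -> exists2 nu, Pn n nu &
      forall i, `|expect mu (f i) - expect nu (f i)| <= d).
Proof.
move=> d0 Pn0 cPn P0 cP weak.
have [J [dir [e e0 H]]] := finitely_many_directions m d0.
have match_sets P1 P2 : P2 !=set0 -> convex_probs P2 ->
    (forall j, dominated e (fun x => \sum_i dir j i * f i x) P1 P2) ->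
    forall mu, P1 mu -> exists2 nu, P2 nu &
      forall i, `|expect mu (f i) - expect nu (f i)| <= d.
  move=> [nu0 P2nu0] cP2 dom mu P1mu.
  have [||j|_ [nu P2nu <-] close] :=
      H [set moments nu | nu in P2] (moments mu) _ (moments_convex cP2) _ (moments_cube mu).
  - by exists (moments nu0), nu0.
  - by move=> _ [nu _ <-]; exact: moments_cube.
  - have [nu P2nu le] := dom j mu P1mu.
    exists (moments nu); first by exists nu.
    by move: le; rewrite !expect_sum.
  - by exists nu.
have cphi j : continuous (fun x => \sum_i dir j i * f i x).
  by apply: continuous_sum => i; exact: (bf i).1.
have bphi j : bounded_continuous (fun x => \sum_i dir j i * f i x).
  apply/bounded_continuousP; split; first exact: cphi.
  exists (\sum_i `|dir j i|) => x; apply: le_trans (ler_norm_sum _ _ _) _.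
  apply: ler_sum => i _; rewrite normrM; have /andP[? ?] := f01 i x.
  by rewrite ler_piMr// ger0_norm.
have : \forall n \near \oo, forall j,
    dominated e (fun x => \sum_i dir j i * f i x) (Pn n) P /\
    dominated e (fun x => \sum_i dir j i * f i x) P (Pn n).
  apply: filter_forall => j; have [_ [M MP]] := (bounded_continuousP _).1 (bphi j).
  have iphi mu := integrable_under_bounded_continuous mu (bphi j).
  apply: (sublinE_cvgP (M := M) Pn0 P0 _ _ _).1 e0 => //; last exact: weak.
  move=> mu _; rewrite -(expect_cst mu M); apply: expect_le => //.
    exact: integrable_under_cst.
  by move=> x; apply: le_trans (ler_norm _) _; exact: MP.
apply: filterS => n dom; split.
  by apply: match_sets => // j; case: (dom j).
by apply: match_sets => // j; case: (dom j).
Qed.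

End matching.

Section weak_tails_wasserstein.
Context {R : realType} {T : polishMetricType R}.
Local Notation prob := (probability (borel T) R).
Implicit Types (mu nu : prob) (P Q : set prob).
Variables (p : R) (p1 : 1 <= p).

Let p0 : 0 <= p := le_trans ler01 p1.

Lemma wasserstein_dist_ge0 mu nu : (0 <= wasserstein_dist p mu nu)%E.
Proof.
by apply: le_ereal_inf_tmp => _ [d [S [Q [X [Y [_ _ ->]]]]]]; exact: poweR_ge0.
Qed.

Lemma wasserstein_dist_le mu nu (c : R) : coupled p c mu nu ->
  (wasserstein_dist p mu nu <= (c `^ p^-1)%:E)%E.
Proof.
move=> [d [S [Q [X [Y [lX lY lt]]]]]].
apply: ge_ereal_inf; eexists; first by exists d, S, Q, X, Y; split.
rewrite -poweR_EFin.
have I0 : (0 <= \int[Q]_s (mdist (X s : T) (Y s : T) `^ p)%:E)%E.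
  by apply: integral_ge0 => s _; rewrite lee_fin powR_ge0.
have c0 : (0 <= c%:E)%E := le_trans I0 (ltW lt).
apply: gt0_ler_poweR; last exact: ltW.
- by rewrite invr_ge0.
- by rewrite in_itv/= I0 leey.
- by rewrite in_itv/= c0 leey.
Qed.

(** The mass c_i kept by part i is the smaller of the two masses, times 1 - d.
    The factor 1 - d only serves to make the leftover mass positive, so that one
    can divide by it.  The constants are chosen so that the leftover mass is at
    most e / K^p, and the cost at most b / 4 + 2^p 4 e = b / 2. *)
Lemma close_parts_coupled mu nu (m : nat) (f : 'I_m -> T -> R) (b s K e : R) (w0 : T) :
  0 < b -> 0 <= s -> 1 <= K -> s `^ p <= b / 4 -> e = b / (16 * 2 `^ p) ->
  moment_under p mu -> moment_under p nu ->
  expect mu (dist_tail p w0 K) <= e -> expect nu (dist_tail p w0 K) <= e ->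
  (forall i, continuous (f i)) -> (forall i x, 0 <= f i x) ->
  (forall x, \sum_i f i x <= 1) ->
  (forall i x y, f i x != 0 -> f i y != 0 -> mdist x y <= s) ->
  1 - e / (2 * K `^ p) <= \sum_i expect mu (f i) ->
  (forall i, `|expect mu (f i) - expect nu (f i)| <= e / (8 * K `^ p * (m%:R + 1))) ->
  coupled p b mu nu.
Proof.
move=> b0 s0 K1 sb eE mommu momnu tmu tnu cf f0 f1 near mass close.
have c20 : 0 < 2 `^ p :> R by exact: powR_gt0.
have e0 : 0 < e by rewrite eE divr_gt0// mulr_gt0.
have K0 : 0 < K `^ p by apply: powR_gt0; lra.
pose eta := e / K `^ p; have eta0 : 0 < eta by rewrite divr_gt0.
pose d := Num.min 2^-1 (eta / 8).
have d0 : 0 < d by rewrite lt_min; apply/andP; split; [lra|rewrite divr_gt0].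
have d1 : d <= 2^-1 by rewrite ge_min lexx.
have d2 : d <= eta / 8 by rewrite ge_min lexx orbT.
have expect0 rho i : 0 <= expect rho (f i) by apply: Rintegral_ge0 => x _.
have expect1 : \sum_i expect mu (f i) <= 1.
  have intf i := integrable_under_bounded_continuous mu (bounded_continuous_part cf f0 f1 i).
  have -> : \sum_i expect mu (f i) = expect mu (fun x => \sum_i 1 * f i x).
    rewrite (expect_sum (index_enum 'I_m) (fun=> 1) intf).
    by apply: eq_bigr => i _; rewrite mul1r.
  rewrite -[X in _ <= X](expect_cst mu 1); apply: expect_le.
  - exact: (integrable_under_sum (index_enum 'I_m) (fun=> 1) intf).
  - exact: integrable_under_cst.
  - by move=> x; under eq_bigr do rewrite mul1r; exact: f1.
pose c i := (1 - d) * Num.min (expect mu (f i)) (expect nu (f i)).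
have min0 i : 0 <= Num.min (expect mu (f i)) (expect nu (f i)).
  by rewrite le_min !expect0.
have c0 i : 0 <= c i by apply: mulr_ge0 => //; lra.
have cmin i : c i <= Num.min (expect mu (f i)) (expect nu (f i)).
  by rewrite ler_piMl//; lra.
have cmu i : c i <= expect mu (f i).
  by apply: le_trans (cmin i) _; rewrite ge_min lexx.
have cnu i : c i <= expect nu (f i).
  by apply: le_trans (cmin i) _; rewrite ge_min lexx orbT.
have csum : \sum_i c i = (1 - d) * \sum_i Num.min (expect mu (f i)) (expect nu (f i)).
  by rewrite mulr_sumr.
have minle : \sum_i Num.min (expect mu (f i)) (expect nu (f i)) <= 1.
  by apply: le_trans expect1; apply: ler_sum => i _; rewrite ge_min lexx.
have c1 : \sum_i c i < 1.
  have : (1 - d) * \sum_i Num.min (expect mu (f i)) (expect nu (f i)) <= (1 - d) * 1.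
    by rewrite ler_wpM2l//; lra.
  by rewrite csum; lra.
have minge : \sum_i expect mu (f i) - eta / 8 <=
    \sum_i Num.min (expect mu (f i)) (expect nu (f i)).
  have step i : expect mu (f i) - eta / (8 * (m%:R + 1)) <=
      Num.min (expect mu (f i)) (expect nu (f i)).
    have m1 : 0 < m%:R + 1 :> R by rewrite ltr_pwDr.
    have q0 : 0 < eta / (8 * (m%:R + 1)) by rewrite divr_gt0// mulr_gt0.
    have := close i; rewrite ler_norml.
    rewrite (_ : e / (8 * K `^ p * (m%:R + 1)) = eta / (8 * (m%:R + 1))); last first.
      by rewrite /eta; field; lra.
    by move=> /andP[? ?]; rewrite le_min; apply/andP; split; lra.
  apply: le_trans (ler_sum _ (fun i _ => step i)).
  rewrite big_split/= lerD2l sumr_const card_ord mulNrn lerN2 -[_ *+ m]mulr_natr.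
  have m0 : 0 <= m%:R :> R by [].
  rewrite (_ : _ * m%:R = (m%:R / (m%:R + 1)) * (eta / 8)); last by field; lra.
  by rewrite ler_piMl//; [lra|rewrite ler_pdivrMr; lra].
have mass' : 1 - eta / 2 <= \sum_i expect mu (f i).
  by move: mass; rewrite (_ : e / (2 * K `^ p) = eta / 2)// /eta; field; lra.
have etale : 1 - \sum_i c i <= eta.
  have : d * \sum_i Num.min (expect mu (f i)) (expect nu (f i)) <= d * 1.
    by rewrite ler_wpM2l// ltW.
  by rewrite csum mulrBl mul1r; lra.
have Keta : K `^ p * (1 - \sum_i c i) <= e.
  apply: le_trans (ler_wpM2l (ltW K0) etale) _.
  by rewrite /eta mulrC divfK// gt_eqF.
apply: (partition_coupled cf f0 f1 c0 c1 p1 cmu cnu mommu momnu s0 (K := K) _ near (w0 := w0)).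
  by lra.
have : 2 `^ p * (K `^ p * (1 - \sum_i c i) + expect mu (dist_tail p w0 K) +
    (K `^ p * (1 - \sum_i c i) + expect nu (dist_tail p w0 K))) <= 2 `^ p * (4 * e).
  by apply: ler_wpM2l; [exact: ltW|lra].
have -> : 2 `^ p * (4 * e) = b / 4 by rewrite eE; field; lra.
by lra.
Qed.

(** The constants are chosen in this order: the diameter s of the bumps and the
    tail bound e from the target g, then K from e, then the number m of bumps
    from e and K, then the precision of the matching from m. *)
Lemma weak_tails_wasserstein_cvg (Pn : nat -> set prob) P (w0 : T) :
  (forall n, wasserstein_space p (Pn n)) -> wasserstein_space p P ->
  sublinE_cvg_weakly Pn P -> tails_vanish p Pn w0 ->
  gen_wasserstein_dist p (Pn n) P @[n --> \oo] --> 0%E.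
Proof.
move=> wPn wP weak tails.
have [P0 cvP cP _] := wP.
have Pn0 n : Pn n !=set0 by have [] := wPn n.
have cvPn n : convex_probs (Pn n) by have [] := wPn n.
apply/ereal_cvg_finP => g g0.
have gge0 n : (0 <= gen_wasserstein_dist p (Pn n) P)%E.
  rewrite le_max; apply/orP; left; have [mu Pmu] := Pn0 n.
  apply: le_ereal_sup_tmp; eexists; first by exists mu.
  by apply: le_ereal_inf_tmp => _ [nu _ <-]; exact: wasserstein_dist_ge0.
pose b := g `^ p; have b0 : 0 < b by exact: powR_gt0.
have pn0 : p != 0 by rewrite gt_eqF//; exact: lt_le_trans ltr01 p1.
have bg : b `^ p^-1 = g by rewrite /b -powRrM mulfV// powRr1// ltW.
pose s := (b / 4) `^ p^-1.
have s0 : 0 < s by apply: powR_gt0; lra.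
have sb : s `^ p = b / 4 by rewrite /s -powRrM mulVf// powRr1//; lra.
pose e := b / (16 * 2 `^ p).
have e0 : 0 < e by rewrite divr_gt0// mulr_gt0// powR_gt0.
have [K1 K11 KP1] := tails _ e0.
have [K2 K21 KP2] := wasserstein_space_tail p1 w0 wP e0.
pose K := Num.max K1 K2.
have K1K : K1 <= K by rewrite le_max lexx.
have K2K : K2 <= K by rewrite le_max lexx orbT.
have K1le : 1 <= K by exact: le_trans K11 K1K.
have KK0 : 0 < K `^ p by apply: powR_gt0; exact: lt_le_trans ltr01 K1le.
have eE : e = b / (16 * 2 `^ p) by [].
clearbody K e s b.
have r0 : 0 < s / 4 by lra.
have [psi [cpsi psi1 dpsi psicvg psinear]] := @bump_sequence R T _ r0.
have psi01 k x : 0 <= psi k x <= 1.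
  elim: k => [|k /andP[IH0 IH1]]; first by rewrite psi1 ler01 lexx.
  by have /andP[-> h] := dpsi k x; exact: le_trans IH1.
have bpsi k : bounded_continuous (psi k).
  apply/bounded_continuousP; split => //; exists 1 => x.
  by have /andP[? ?] := psi01 k x; rewrite ger0_norm.
have bcst0 : bounded_continuous (cst 0 : T -> R).
  apply/bounded_continuousP; split; first exact: cst_continuous.
  by exists 0 => x; rewrite normr0.
have e40 : 0 < e / (4 * K `^ p) by rewrite divr_gt0// mulr_gt0.
(* Dini's theorem for the sequence psi_k decreasing to 0. *)
have [m [nu0 Pnu0 small]] : exists m, exists2 nu, P nu & forall mu, P mu ->
    expect mu (psi m) <= expect nu (cst 0) + e / (4 * K `^ p).
  apply: (dini_compact P0 cP bpsi bcst0 _ psicvg e40) => k x.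
  by case/andP: (dpsi k x).
rewrite expect_cst add0r in small.
pose f (i : 'I_m) (x : T) := psi i x - psi i.+1 x.
have f0 i x : 0 <= f i x by rewrite subr_ge0; case/andP: (dpsi i x).
have f01 i x : 0 <= f i x <= 1.
  rewrite f0 /f; have /andP[? _] := psi01 i.+1 x; have /andP[_ ?] := psi01 i x.
  by apply/andP; split => //; lra.
have cf i : continuous (f i).
  by move=> x; apply: (@continuousB R R^o T (psi i)); exact: cpsi.
(* The bumps add up to psi_0 - psi_m = 1 - psi_m. *)
have telescope (u : nat -> R) k : \sum_(i < k) (u i - u i.+1) = u 0%N - u k.
  by elim: k => [|k IH]; rewrite ?big_ord0 ?subrr// big_ord_recr/= IH addrA subrK.
have f1 x : \sum_i f i x <= 1.
  rewrite (telescope (psi ^~ x)) psi1 lerBlDr lerDl.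
  by case/andP: (psi01 m x).
have near (i : 'I_m) x y : f i x != 0 -> f i y != 0 -> mdist x y <= s.
  rewrite /f !subr_eq0 => hx hy.
  by have := psinear _ _ _ hx hy; rewrite mulrC divfK.
have mass mu : expect mu (psi m) <= e / (2 * K `^ p) ->
    1 - e / (2 * K `^ p) <= \sum_i expect mu (f i).
  move=> le; have ipsi k := integrable_under_bounded_continuous mu (bpsi k).
  rewrite (eq_bigr (fun i : 'I_m => expect mu (psi i) - expect mu (psi i.+1))).
    rewrite (telescope (fun k => expect mu (psi k))).
    rewrite (_ : psi 0%N = cst 1) ?expect_cst; last by apply/funext => x; rewrite psi1.
    by rewrite lerD2l lerN2.
  by move=> i _; rewrite -expectB.
have halve : e / (2 * K `^ p) = e / (4 * K `^ p) + e / (4 * K `^ p) by field; lra.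
have psiP mu : P mu -> expect mu (psi m) <= e / (2 * K `^ p).
  by move=> Pmu; have := small _ Pmu; rewrite halve; lra.
have [_ [M psiM]] := (bounded_continuousP _).1 (bpsi m).
have dom := (sublinE_cvg_growthP p1 wPn wP (cpsi m) (bounded_has_growth p psiM)).1
  (weak _ (bpsi m)) _ e40.
have d0 : 0 < e / (8 * K `^ p * (m%:R + 1)).
  by rewrite divr_gt0// !mulr_gt0// ltr_pwDr.
have bf i : bounded_continuous (f i).
  by apply/bounded_continuousP; split => //; exists 1 => x; rewrite ger0_norm//;
    case/andP: (f01 i x).
have matching := weak_cvg_matches_parts bf f01 d0 Pn0 cvPn P0 cvP weak.
apply: filterS3 dom matching (KP1 K K1K) => n [domn _] [match1 match2] tailn.
have psiPn mu : Pn n mu -> expect mu (psi m) <= e / (2 * K `^ p).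
  move=> Pmu; have [nu Pnu le] := domn _ Pmu; apply: le_trans le _.
  by rewrite halve lerD2r small.
have cpl mu nu : moment_under p mu -> moment_under p nu ->
    expect mu (dist_tail p w0 K) <= e -> expect nu (dist_tail p w0 K) <= e ->
    expect mu (psi m) <= e / (2 * K `^ p) ->
    (forall i, `|expect mu (f i) - expect nu (f i)| <= e / (8 * K `^ p * (m%:R + 1))) ->
    coupled p b mu nu.
  move=> mommu momnu tmu tnu psimu close.
  apply: (close_parts_coupled b0 (ltW s0) K1le _ eE mommu momnu tmu tnu cf f0 f1 near _ close).
    by rewrite sb.
  exact: mass.
rewrite sub0r add0r; apply/andP; split.
  by apply: le_trans (gge0 n); rewrite lee_fin; lra.
rewrite -bg ge_max; apply/andP; split; apply: ge_ereal_sup => _ [mu Pmu <-].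
  have [nu Pnu close] := match1 _ Pmu.
  apply: ge_ereal_inf; eexists; first by exists nu.
  apply: wasserstein_dist_le; apply: cpl => //.
  - exact: (wasserstein_space_moment p1 (wPn n)).
  - exact: (wasserstein_space_moment p1 wP).
  - exact: tailn.
  - exact: KP2.
  - exact: psiPn.
have [nu Pnu close] := match2 _ Pmu.
apply: ge_ereal_inf; eexists; first by exists nu.
apply: wasserstein_dist_le; apply: (@coupled_sym _ _ p).
apply: cpl => //.
- exact: (wasserstein_space_moment p1 wP).
- exact: (wasserstein_space_moment p1 (wPn n)).
- exact: KP2.
- exact: tailn.
- exact: psiP.
Qed.

End weak_tails_wasserstein.

(** * The equivalence *)

Theorem theorem3p4 (R : realType) (Omega : polishMetricType R) (p : R)
    (Pn : nat -> set (probability (borel Omega) R))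
    (P : set (probability (borel Omega) R)) (w0 : Omega) :
  1 <= p ->
  (forall n, wasserstein_space p (Pn n)) ->
  wasserstein_space p P ->
  let i := gen_wasserstein_dist p (Pn n) P @[n --> \oo] --> 0%E in
  let ii := forall phi : Omega -> R, continuous phi ->
    (exists (w1 : Omega) (C : R),
       forall w, `|phi w| <= C * (1 + mdist w1 w `^ p)) ->
    sublinE (Pn n) phi @[n --> \oo] --> sublinE P phi in
  let iii := sublinE_cvg_weakly Pn P /\
    limn_esup (fun n => sublinE (Pn n) (dist_tail p w0 K))
      @[K --> +oo] --> 0%E in
  (i <-> ii) /\ (ii <-> iii).
Proof.
move=> p1 wPn wP i ii iii.
have iii_tails : iii <-> sublinE_cvg_weakly Pn P /\ tails_vanish p Pn w0.
  by rewrite /iii limn_esup_tailP.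
have i_iii : i -> iii.
  move=> Hi; apply/iii_tails; split; first exact: (wasserstein_cvg_weakly p1 wPn wP).
  exact: (wasserstein_cvg_tails p1 w0 wPn wP).
have iii_i : iii -> i.
  by move=> /iii_tails[weak tails]; exact: (weak_tails_wasserstein_cvg p1 wPn wP weak tails).
have ii_iii : ii <-> iii.
  split => [Hii|/iii_tails[weak tails]].
    apply/iii_tails; split; first exact: (growth_cvg_weakly (p := p)).
    exact: (growth_cvg_tails p1 w0 wPn wP).
  exact: (weak_tails_growth_cvg p1 wPn wP weak tails).
split=> //; split => [/i_iii/ii_iii//|/ii_iii/iii_i//].
Qed.
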